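(* Let $\mathbb{F}$ be a field of characteristic not $2$, and let $i$ be an element of $\mathbb{F}$ such that $i^2=-1$. Let $A\in\mathrm{GL}_n(\mathbb{F})$, and let $r\geq n$ be an integer such that $i^r\det A=\pm 1$. Then the matrix $A\oplus(i\,I_r)\in\mathrm{GL}_{n+r}(\mathbb{F})$ is the product of one involution and two $U_2$-matrices.
   Context: $A\oplus B$ denotes the block-diagonal matrix with diagonal blocks $A$ and $B$. A matrix $S\in\mathrm{GL}_m(\mathbb{F})$ is an involution if $S^2=I_m$, and a $U_2$-matrix (unipotent of index $2$) if $(S-I_m)^2=0$; $I_m$ is both. The product is of three factors of the stated types in some order (a matrix that is such a product in one prescribed order is also such a product in any other order). *)

(* Defs.v *)
From mathcomp Require Import all_boot all_order all_algebra.

Set Implicit Arguments.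
Unset Strict Implicit.
Unset Printing Implicit Defensive.

Import GRing.Theory.
Local Open Scope ring_scope.

Definition is_involution (F : fieldType) (m : nat) (S : 'M[F]_m) : Prop :=
  S \in unitmx /\ S *m S = 1%:M.

Definition is_U2 (F : fieldType) (m : nat) (S : 'M[F]_m) : Prop :=
  S \in unitmx /\ (S - 1%:M) *m (S - 1%:M) = 0.

Definition direct_sum_mx (F : fieldType) (m1 m2 : nat)
    (A : 'M[F]_m1) (B : 'M[F]_m2) : 'M[F]_(m1 + m2) :=
  block_mx A 0 0 B.

(* The order of the three factors is left free; the order of the two U_2-factors
   between themselves is absorbed by the names U and V. *)
Definition is_prod_involution_U2_U2 (F : fieldType) (m : nat)
    (M : 'M[F]_m) : Prop :=
  exists S U V : 'M[F]_m,
    [/\ is_involution S, is_U2 U, is_U2 V &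
        [\/ M = S *m U *m V, M = U *m S *m V | M = U *m V *m S]].

(* Main.v *)
Require Import Defs.
From mathcomp Require Import all_boot all_order all_algebra ring zify.

Set Implicit Arguments.
Unset Strict Implicit.
Unset Printing Implicit Defensive.

Import GRing.Theory.
Local Open Scope ring_scope.

(** Why the theorem holds.  Write t for the polynomial variable and call a
    matrix V with (V - 1)^2 = 0 a U2-matrix.

    Since r >= n, the matrix A (+) i I_r is similar to the direct sum of
    [[i, 1], [0, A']] and of a scalar matrix i I_k, where A' describes the
    action of A on the row space of A - i ([mxsimilar_rank_reduction]).  The
    matrix i I_2 is itself a product of one involution and two U2-matrices, so
    only the parity of k matters.  Multiplying [[i, 1], [0, A']] by a U2-matrix
    turns it into a conjugate of K = [[0, 1], [B, Y]] with B = - i A' and with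
    Y arbitrary ([U2_inv_U2_of_quad_model]); if k is odd, one more scalar i is
    adjoined to K, with an arbitrary coupling column.  It remains to choose Y so
    that K is the product of an involution and a U2-matrix.

    K is the linearization of the quadratic matrix polynomial t^2 - t Y - B.
    If e_1, ..., e_n are polynomials such that the e_j and the t e_j form a basis
    of F[t]/(p) and t^2 e - B e lies in the span of the t e_j, then K is, for
    some Y, the matrix of the multiplication by t on F[t]/(p) ([quad_model]).
    All matrices of this multiplication are similar ([model_similar]), so it is
    enough that one of them is an involution times a U2-matrix.  This is so if
    p = (t - e)(t - e')^k s with e and e' equal to 1 or -1, k <= 1, and s skew
    reciprocal, that is, up to sign invariant under s(t) -> t^(2m) s(-1/t)
    ([inv_U2_model]).

    The core is [quad_model_exists]: for every invertible B and every a <> 0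
    there is a quadratic model of B with p = (t - a)(t - b) s, where
    b = - det B / a and s is skew reciprocal.  For a companion matrix this reduces
    to finding a skew reciprocal s such that (t - b) s has a prescribed odd part
    ([skewrec_odd_part]).  In general B is similar to a direct sum of companion
    matrices.  The models of two summands are concatenated by multiplying their
    polynomials p ([quad_model_block]); the second root of one block is chosen to be
    paired with the first root of the next, because (t - b)(t + 1/b) is
    skew reciprocal ([skewrec1]).  No eigenvalues have to be distinct, which is
    what makes the argument work over small fields.

    Finally the hypothesis on the determinant says that (det B)^2 = (-1)^k.
    For k even, a = 1 gives p = (t - 1)(t + det B) s with det B = 1 or -1.  For
    k odd, a = i det B is 1 or -1 and b = i; the adjoined scalar i supplies a
    second factor t - i, and (t - i)^2 is skew reciprocal ([U2_inv_U2_core]). *)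

Local Notation Cmx := (map_mx polyC).

(** * Similarity of matrices *)

(** The two sizes are kept distinct, so that sizes which are only provably equal
    need no casts. *)
Definition mxsimilar (F : fieldType) a b (M : 'M[F]_a) (N : 'M[F]_b) :=
  exists (P : 'M_(b, a)) (Q : 'M_(a, b)),
    [/\ P *m Q = 1%:M, Q *m P = 1%:M & P *m M = N *m P].

Lemma row_free_inverse (F : fieldType) a b (P : 'M[F]_(b, a)) :
  a = b -> row_free P -> exists Q, P *m Q = 1%:M /\ Q *m P = 1%:M.
Proof.
move=> ab; rewrite -{b}ab in P *; rewrite row_free_unit => uP.
by exists (invmx P); rewrite mulmxV // mulVmx.
Qed.

(** * Splitting off a companion block *)

(** The annihilator of the row vector w in F[t], acting through B, is generated
    by f. *)
Definition is_order (F : fieldType) n (B : 'M[F]_n.+1) (w : 'rV_n.+1)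
    (f : {poly F}) :=
  forall h : {poly F}, (w *m horner_mx B h == 0) = (f %| h).

Definition krylov (F : fieldType) n (B : 'M[F]_n.+1) (w : 'rV_n.+1) d :=
  \matrix_(k < d) (w *m B ^+ k).

Lemma mul_krylov (F : fieldType) n (B : 'M[F]_n.+1) w d (u : 'rV_d) :
  u *m krylov B w d = w *m horner_mx B (rVpoly u).
Proof.
rewrite horner_rVpoly !(mulmx_sum_row u) linear_sum mulmx_sumr.
by apply: eq_bigr => k _; rewrite linearZ /= !rowK mxvecK scalemxAr.
Qed.

Lemma order_exists (F : fieldType) n (B : 'M[F]_n.+1) (w : 'rV_n.+1) :
  exists2 f, f != 0 & is_order B w f.
Proof.
have dep_ex : exists d, ~~ row_free (krylov B w d).
  by exists n.+2; apply/negP => /eqP r; have := rank_leq_col (krylov B w n.+2);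
    rewrite r ltnn.
case: (ex_minnP dep_ex) => d dep min_d.
have := dep; rewrite -kermx_eq0 => /rowV0Pn[u /sub_kermxP uK u0].
have f0 : rVpoly u != 0.
  by apply: contraNneq u0 => /(congr1 (@poly_rV _ d)); rewrite rVpolyK linear0 => ->.
exists (rVpoly u) => // h; have wf : w *m horner_mx B (rVpoly u) = 0 by rewrite -mul_krylov.
have wr : w *m horner_mx B h = w *m horner_mx B (h %% rVpoly u).
  rewrite {1}(divp_eq h (rVpoly u)) rmorphD mulmxDr mulrC rmorphM /= -mulmxE.
  by rewrite mulmxA wf mul0mx add0r.
apply/eqP/idP => [hw|fh]; last by rewrite wr (modp_eq0 fh) rmorph0 mulmx0.
apply: contraT => nfh; set r := h %% rVpoly u in wr; have r0 : r != 0 by [].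
have sr : (size (r) <= d.-1)%N.
  have: (size (r) < d)%N by rewrite (leq_trans (ltn_modpN0 _ f0)) ?size_poly.
  by case: (d).
have d0 : (d.-1 < d)%N.
  by case: (d) dep => // /negP[]; rewrite /row_free [krylov _ _ _]flatmx0 mxrank0.
suff: ~~ row_free (krylov B w d.-1) by move/min_d; rewrite leqNgt d0.
rewrite -kermx_eq0; apply/rowV0Pn; exists (poly_rV (r)).
  by apply/sub_kermxP; rewrite mul_krylov poly_rV_K // -wr hw.
by apply: contraNneq r0 => /(congr1 rVpoly); rewrite poly_rV_K // linear0 => ->.
Qed.

(** The common part G of f and g is distributed between them: the factors of G
    coprime to u = g / G go to f, the others to g.  This replaces a
    factorization into irreducibles. *)
Lemma lcm_coprime_split (F : fieldType) (f g : {poly F}) : f != 0 -> g != 0 ->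
  exists f1 g1, [/\ f1 %| f, g1 %| g, coprimep f1 g1, f %| f1 * g1 & g %| f1 * g1].
Proof.
move=> f0 g0; set G := gcdp f g.
have G0 : G != 0 by rewrite gcdp_eq0 negb_and f0.
have [u1 fE] : exists u1, f = G * u1 by exists (f %/ G); rewrite mulrC divpK ?dvdp_gcdl.
have [u gE] : exists u, g = G * u by exists (g %/ G); rewrite mulrC divpK ?dvdp_gcdr.
have cu : coprimep u1 u.
  have /eqP : size (gcdp u1 u) == 1%N; last by move=> s; rewrite /coprimep s.
  have: G %= G * gcdp u1 u.
    by rewrite eqp_sym (eqp_trans (mulp_gcdr _ _ _)) // -fE -gE eqpxx.
  rewrite -{1}[G]mulr1 eqp_mul2l // => /eqp_size; rewrite size_poly1.
  by move=> <-.
case: (gdcopP u G) => k kG; rewrite (negPf G0) orbF => cku kmax.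
have [h GE] : exists h, G = k * h by exists (G %/ k); rewrite mulrC divpK.
have k0 : k != 0 by apply: contraNneq G0 => k0; rewrite GE k0 mul0r.
have copr d : coprimep d u -> coprimep d h.
  move=> cdu; have: k * gcdp d h %| k.
    apply: kmax; first by rewrite GE dvdp_mul2l // dvdp_gcdr.
    by rewrite coprimepMl cku (coprimep_dvdr (dvdp_gcdl _ _)).
  by rewrite -{2}[k]mulr1 dvdp_mul2l // dvdp1.
exists (k * u1), (h * u); split.
- by rewrite fE GE mulrAC dvdp_mulr.
- by rewrite gE GE -mulrA dvdp_mull.
- by rewrite !coprimepMl !coprimepMr cku cu !copr.
- by rewrite fE GE mulrACA mulrA dvdp_mulr.
- by rewrite gE GE mulrACA [u1 * u]mulrC mulrA dvdp_mulr.
Qed.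

(** Take the image of w under (f / h)(B). *)
Lemma order_divisor (F : fieldType) n (B : 'M[F]_n.+1) w f h : f != 0 ->
  is_order B w f -> h %| f -> exists v, is_order B v h.
Proof.
move=> f0 ow hf; exists (w *m horner_mx B (f %/ h)) => k.
rewrite -mulmxA mulmxE -rmorphM ow -{1}(divpK hf) dvdp_mul2l //.
by apply: contraNneq f0 => e; rewrite -(divpK hf) e mul0r.
Qed.

Lemma order_add (F : fieldType) n (B : 'M[F]_n.+1) v w f g : coprimep f g ->
  is_order B v f -> is_order B w g -> is_order B (v + w) (f * g).
Proof.
move=> cfg ov ow h; apply/idP/idP => [/eqP e|fgh]; last first.
  have fh : f %| h by apply: dvdp_trans fgh; rewrite dvdp_mulr.
  have gh : g %| h by apply: dvdp_trans fgh; rewrite dvdp_mull.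
  move: fh gh; rewrite -ov -ow => /eqP vh /eqP wh.
  by rewrite mulmxDl vh wh addr0.
have key (x y : 'rV_n.+1) a b : coprimep a b -> is_order B x a -> is_order B y b ->
    (x + y) *m horner_mx B h = 0 -> b %| h.
  move=> cab ox oy xyh; rewrite -(Gauss_dvdpr _ (_ : coprimep b a)) 1?coprimep_sym //.
  have : x *m horner_mx B (a * h) == 0 by rewrite ox dvdp_mulr.
  have : (x + y) *m horner_mx B (a * h) = 0.
    by rewrite mulrC rmorphM /= -mulmxE mulmxA xyh mul0mx.
  by rewrite -oy mulmxDl => xy0 /eqP x0; rewrite x0 add0r in xy0; rewrite xy0.
rewrite Gauss_dvdp // (key v w f g cfg ov ow e) andbT.
by apply: (key w v g f); rewrite 1?coprimep_sym // addrC.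
Qed.

(** The vectors of the standard basis are treated one at a time, keeping a vector
    whose order is a multiple of all the orders met so far: orders can be replaced
    by coprime divisors with the same least common multiple, and coprime orders
    multiply when vectors are added. *)
Lemma cyclic_vector_minpoly (F : fieldType) n (B : 'M[F]_n.+1) :
  exists v (f : {poly F}), [/\ f != 0, is_order B v f & horner_mx B f = 0].
Proof.
suff partial k : exists v f, [/\ f != 0, is_order B v f &
    forall j : 'I_n.+1, (j < k)%N -> delta_mx 0 j *m horner_mx B f = 0 :> 'rV_n.+1].
  have [v [f [f0 ov fk]]] := partial n.+1; exists v, f; split=> //.
  by apply/row_matrixP => j; rewrite rowE fk // row0.
elim: k => [|k [v [f [f0 ov fk]]]].
  by have [f f0 of0] := order_exists B 0; exists 0, f.
have [ltkn|lenk] := ltnP k n.+1; last first.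
  by exists v, f; split=> // j _; apply: fk; apply: leq_trans lenk.
have [g g0 og] := order_exists B (delta_mx 0 (Ordinal ltkn)).
have [f1 [g1 [f1f g1g c1 fd gd]]] := lcm_coprime_split f0 g0.
have [v1 ov1] := order_divisor f0 ov f1f.
have [w1 ow1] := order_divisor g0 og g1g.
exists (v1 + w1), (f1 * g1); split=> [||j].
- by rewrite mulf_neq0 // ?(dvdpN0 f1f) ?(dvdpN0 g1g).
- exact: order_add.
rewrite ltnS leq_eqVlt => /predU1P[jk|ltjk].
  by rewrite (_ : j = Ordinal ltkn); [apply/eqP; rewrite og | apply: val_inj].
have [h ->] := dvdpP _ _ fd; rewrite mulrC rmorphM /= -mulmxE mulmxA fk // mul0mx //.
Qed.

Lemma krylov_mul (F : fieldType) n (B : 'M[F]_n.+1) v (f : {poly F}) :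
  f \is monic -> is_order B v f ->
  krylov B v (size f).-1 *m B = companionmx f *m krylov B v (size f).-1.
Proof.
move=> mf ov; apply/row_matrixP => k; rewrite !row_mul rowK mul_krylov.
have -> : rVpoly (row k (companionmx f)) = 'X^(k.+1) - (k == (size f).-2 :> nat)%:R *: f.
  apply/polyP => j; rewrite coefB coefZ coefXn coef_rVpoly.
  case: insubP => [j' _ <-|]; rewrite ?mxE.
    case: eqVneq => [->|_]; last by rewrite mul0r subr0 eq_sym.
    by rewrite prednK ?(leq_ltn_trans _ (ltn_ord k)) // ltn_eqF //= sub0r mul1r.
  rewrite -leqNgt => lej; have [kE|nk] := eqVneq (k : nat) (size f).-2; last first.
    have ltk : (k.+1 < (size f).-1)%N.
      rewrite ltn_neqAle ltn_ord andbT; apply: contraNneq nk => e.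
      exact/eqP/(congr1 predn e).
    by rewrite /= mul0r subr0 gtn_eqF // (leq_trans ltk).
  have sf : (size f).-1 = k.+1 by rewrite kE prednK ?(leq_ltn_trans _ (ltn_ord k)).
  rewrite mul1r -sf; have [->|nj] := eqVneq j (size f).-1.
    by have /eqP := mf; rewrite lead_coefE => ->; rewrite subrr.
  rewrite nth_default ?subr0 //.
  by apply: leq_trans (leqSpred _) _; rewrite ltn_neqAle eq_sym nj.
rewrite rmorphB mulmxBr /= horner_mxZ -scalemxAr (eqP (_ : v *m horner_mx B f == 0)) ?ov //.
by rewrite scaler0 subr0 rmorphXn /= horner_mx_X exprSr -mulmxE mulmxA.
Qed.

(** The cyclic subspace of a vector v whose order is the minimal polynomial f has
    an invariant complement: choose a linear form phi that vanishes on v B^j for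
    j < d - 1 and equals 1 on v B^(d-1), and take the common kernel of the forms
    w |-> w B^j phi.  It is invariant because f(B) = 0, and it meets the cyclic
    subspace trivially because the matrix of the v B^(j+k) phi is antitriangular. *)
Lemma rational_split (F : fieldType) n (B : 'M[F]_n.+1) :
  exists (f : {poly F}) m (B' : 'M_m), [/\ f \is monic, (1 < size f)%N,
    n.+1 = ((size f).-1 + m)%N & mxsimilar B (block_mx (companionmx f) 0 0 B')].
Proof.
have [v [f0 [f0n of0 f0B]]] := cyclic_vector_minpoly B.
pose f : {poly F} := (lead_coef f0)^-1 *: f0.
have lf0 : (lead_coef f0)^-1 != 0 by rewrite invr_eq0 lead_coef_eq0.
have mf : f \is monic by rewrite monicE lead_coefZ mulVf // lead_coef_eq0.
have ov : is_order B v f by move=> h; rewrite of0 dvdpZl.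
have fB : horner_mx B f = 0 by rewrite horner_mxZ f0B scaler0.
have sf : (1 < size f)%N.
  rewrite ltnNge; apply/negP => /size1_polyC fc; move: fB mf; rewrite fc horner_mx_C.
  move/matrixP/(_ 0 0); rewrite !mxE eqxx mulr1n => ->.
  by rewrite monicE lead_coefC eq_sym oner_eq0.
set d := (size f).-1; have sfd : size f = d.+1 by rewrite prednK // ltnW.
have d_gt0 : (0 < d)%N by rewrite -ltnS -sfd.
set Kr := krylov B v d.
have freeKr : row_free Kr.
  rewrite -kermx_eq0; apply/rowV0P => u /sub_kermxP.
  rewrite mul_krylov => /eqP; rewrite ov => fu; apply: (can_inj rVpolyK).
  rewrite linear0; apply/eqP; apply: contraTT fu => u0.
  by rewrite gtNdvdp // sfd ltnS size_poly.
have lastP : (d.-1 < d)%N by rewrite prednK.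
pose phi : 'cV_n.+1 := pinvmx Kr *m delta_mx (Ordinal lastP) 0.
have phiE (h : {poly F}) : (size h <= d)%N -> (v *m horner_mx B h *m phi) 0 0 = h`_d.-1.
  move=> sh; rewrite -(poly_rV_K sh) -mul_krylov -mulmxA [Kr *m _]mulmxA.
  by rewrite mulmxVp // mul1mx -colE !mxE poly_rV_K.
pose L : 'M_(n.+1, d) := \matrix_(i, j) (B ^+ j *m phi) i 0.
have mulL m (W : 'M_(m, n.+1)) (j : 'I_d) : col j (W *m L) = W *m B ^+ j *m phi.
  rewrite colE -[W *m L *m _]mulmxA -colE -mulmxA; congr (_ *m _).
  by apply/colP => i; rewrite !mxE.
have kerL m (W : 'M_(m, n.+1)) (h : {poly F}) : W *m L = 0 -> W *m horner_mx B h *m phi = 0.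
  move=> WL; rewrite (divp_eq h f) rmorphD rmorphM /= fB mulr0 add0r.
  have /poly_rV_K <- : (size (h %% f)%R <= d)%N by rewrite -ltnS -sfd ltn_modp monic_neq0.
  rewrite horner_rVpoly mulmx_sum_row linear_sum mulmx_sumr mulmx_suml big1 // => j _.
  by rewrite linearZ /= rowK mxvecK -scalemxAr -scalemxAl -mulL WL col0 scaler0.
have freeH : row_free (Kr *m L).
  rewrite -kermx_eq0; apply/rowV0P => u /sub_kermxP uH.
  apply: (can_inj rVpolyK); rewrite linear0; apply/eqP; apply: contraT => u0.
  set h := rVpoly u in u0; have sh : (size h <= d)%N := size_poly _ _.
  have jP : (d - size h < d)%N by rewrite ltn_subrL size_poly_gt0 u0.
  have : (v *m horner_mx B (h * 'X^(d - size h)) *m phi) 0 0 = 0.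
    have /colP/(_ 0) := mulL _ (u *m Kr) (Ordinal jP).
    by rewrite -mulmxA uH col0 mul_krylov rmorphM rmorphXn /= horner_mx_X -mulmxE mulmxA mxE => <-.
  rewrite phiE; last by rewrite (leq_trans (size_polyMleq _ _)) // size_polyXn addnS subnKC.
  rewrite coefMXn ltnNge -ltnS prednK // jP /=.
  rewrite -subn1 subnAC subKn // subn1 => /eqP.
  by rewrite -lead_coefE lead_coef_eq0 (negPf u0).
have rankL : \rank L = d.
  apply/eqP; rewrite eqn_leq rank_leq_col /=.
  by rewrite -{1}(eqP freeH) mxrankM_maxr.
have dimE : n.+1 = (d + \rank (kermx L))%N.
  by rewrite mxrank_ker rankL subnKC // -rankL rank_leq_row.
pose Z := row_base (kermx L).
have ZL : Z *m L = 0 by apply/sub_kermxP; rewrite eq_row_base.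
pose B' := Z *m B *m pinvmx Z.
have ZB : Z *m B = B' *m Z.
  rewrite mulmxKpV // eq_row_base; apply/sub_kermxP.
  apply/matrixP => i j; have /colP/(_ i) := mulL _ (Z *m B) j; rewrite [LHS]mxE => ->.
  rewrite -[Z *m B *m _]mulmxA mulmxE -exprS -[in B ^+ _](horner_mx_X B) -rmorphXn /=.
  by rewrite kerL // !mxE.
exists f, (\rank (kermx L)), B'; split=> //.
have [|Q [PQ QP]] := @row_free_inverse F n.+1 _ (col_mx Kr Z) dimE.
  rewrite -kermx_eq0; apply/rowV0P => u /sub_kermxP.
  rewrite -[u]hsubmxK mul_row_col => uP.
  have u1 : lsubmx u = 0.
    apply: (row_free_inj freeH); rewrite mul0mx.
    have := congr1 (mulmx^~ L) uP; rewrite /= mulmxDl mul0mx -[_ *m Z *m L]mulmxA.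
    by rewrite ZL mulmx0 addr0 mulmxA.
  have u2 : rsubmx u = 0.
    apply: (row_free_inj (row_base_free (kermx L))).
    by move: uP; rewrite u1 !mul0mx add0r.
  by rewrite u1 u2 row_mx0.
exists (col_mx Kr Z), Q; split=> //.
by rewrite mul_col_mx mul_block_col !mul0mx addr0 add0r -krylov_mul // ZB.
Qed.

(** * Matrices of the multiplication by t modulo a polynomial *)

(** Linear independence over F of the entries of x modulo p. *)
Definition free_mod (F : fieldType) N (p : {poly F}) (x : 'cV[{poly F}]_N) :=
  forall r : 'rV[F]_N, p %| (Cmx r *m x) 0 0 -> r = 0.

(** The entries of x form a basis of F[t]/(p), in which T is the matrix of the
    multiplication by t. *)
Definition model (F : fieldType) N (p : {poly F}) (T : 'M[F]_N)
    (x : 'cV[{poly F}]_N) :=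
  [/\ size p = N.+1, free_mod p x & exists q, 'X *: x = Cmx T *m x + p *: q].

Lemma free_modP (F : fieldType) a N (p : {poly F}) (x : 'cV_N) (R : 'M_(a, N)) q :
  free_mod p x -> Cmx R *m x = p *: q -> R = 0.
Proof.
move=> fx Rx; apply/row_matrixP => i; rewrite row0; apply: fx.
by rewrite map_row -row_mul Rx !mxE dvdp_mulr.
Qed.

Lemma free_mod_generates (F : fieldType) a N (p : {poly F}) (x : 'cV_N) (y : 'cV_a) :
  size p = N.+1 -> free_mod p x -> exists G q, y = Cmx G *m x + p *: q.
Proof.
move=> sp fx; pose c f : 'rV_N := poly_rV (f %% p).
have p0 : p != 0 by rewrite -size_poly_eq0 sp.
have cK f : rVpoly (c f) = f %% p by rewrite poly_rV_K // -ltnS -sp ltn_modp.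
have c0 f : (c f == 0) = (p %| f).
  apply/eqP/modp_eq0P => [|fp]; last by rewrite /c fp linear0.
  by move/(congr1 rVpoly); rewrite cK linear0.
pose X b (z : 'cV[{poly F}]_b) : 'M[F]_(b, N) := \matrix_i c (z i 0).
have cM b (z : 'cV_b) (r : 'rV_b) : c ((Cmx r *m z) 0 0) = r *m X b z.
  rewrite mxE [RHS]mulmx_sum_row; apply: (can_inj rVpolyK); rewrite cK linear_sum /=.
  rewrite (big_morph (fun f => f %% p) (fun f g => modpD p f g) (mod0p p)).
  apply: eq_bigr => j _; rewrite linearZ /= rowK cK mxE mul_polyC.
  by rewrite modpZl.
have uX : X N x \in unitmx.
  rewrite -row_free_unit -kermx_eq0; apply/rowV0P => r /sub_kermxP rX.
  by apply: fx; rewrite -c0 cM rX.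
pose G := X a y *m invmx (X N x); exists G.
exists (\col_i ((y - Cmx G *m x) i 0 %/ p)).
suff dvd i : p %| (y - Cmx G *m x) i 0.
  rewrite -[LHS](subrK (Cmx G *m x)) addrC; congr (_ + _).
  by apply/colP => i; rewrite [RHS]mxE [in RHS]mxE mulrC divpK.
have -> : (y - Cmx G *m x) i 0 = (Cmx (row_mx (delta_mx 0 i) (- row i G)) *m col_mx y x) 0 0.
  rewrite map_row_mx mul_row_col map_delta_mx -rowE map_mxN map_row mulNmx -row_mul.
  by rewrite !mxE.
rewrite -c0 cM (_ : X _ _ = col_mx (X a y) (X N x)).
  by rewrite mul_row_col -rowE mulNmx -row_mul mulmxKV // subrr.
by apply/row_matrixP => k; rewrite rowK; case: (split_ordP k) => l ->;
  rewrite ?(col_mxEu, col_mxEd, rowKu, rowKd) rowK.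
Qed.

Lemma model_similar (F : fieldType) a b (p : {poly F}) (T : 'M[F]_a) x (K : 'M_b) y :
  model p T x -> model p K y -> mxsimilar K T.
Proof.
move=> [sx fx [qx xE]] [sy fy [qy yE]].
have [G [q yG]] := free_mod_generates y sx fx.
have [H [h xH]] := free_mod_generates x sy fy.
have xE' : x = Cmx H *m Cmx G *m x + p *: (Cmx H *m q + h).
  by rewrite [LHS]xH yG mulmxDr mulmxA -scalemxAr -addrA -scalerDr.
have yE' : y = Cmx G *m Cmx H *m y + p *: (Cmx G *m h + q).
  by rewrite [LHS]yG xH mulmxDr mulmxA -scalemxAr -addrA -scalerDr.
exists H, G; split.
- apply/eqP; rewrite -subr_eq0; apply/eqP.
  apply: (free_modP (q := - (Cmx H *m q + h)) fx).
  by rewrite map_mxB map_mxM map_mx1 mulmxBl mul1mx {2}xE' opprD addrA subrr sub0r scalerN.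
- apply/eqP; rewrite -subr_eq0; apply/eqP.
  apply: (free_modP (q := - (Cmx G *m h + q)) fy).
  by rewrite map_mxB map_mxM map_mx1 mulmxBl mul1mx {2}yE' opprD addrA subrr sub0r scalerN.
apply/eqP; rewrite -subr_eq0; apply/eqP.
apply: (free_modP (q := qx + Cmx T *m h - 'X *: h - Cmx H *m qy) fy).
have Hy : Cmx H *m y = x - p *: h by rewrite [x in RHS]xH addrK.
rewrite map_mxB !map_mxM mulmxBl -!mulmxA Hy mulmxBr -scalemxAr.
have -> : Cmx K *m y = 'X *: y - p *: qy by rewrite yE addrK.
have -> : Cmx T *m x = 'X *: x - p *: qx by rewrite xE addrK.
rewrite mulmxBr -!scalemxAr Hy; move: (Cmx H *m qy) (Cmx T *m h) => u v.
by apply/colP => k; rewrite !mxE; ring.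
Qed.

(** * Skew reciprocal polynomials *)

(** The polynomials t^m c(t - 1/t) with c of degree at most m.  In this form, a
    basis of F[t]/(f) adapted to the involution t -> -1/t is at hand. *)
Definition skewrec_span (F : fieldType) m (f : {poly F}) :=
  exists c : nat -> F, f = \sum_(k < m.+1) c k *: ('X^(m - k) * ('X^2 - 1) ^+ k).

Definition skewrec (F : fieldType) m (f : {poly F}) :=
  [/\ skewrec_span m f, f \is monic & size f = m.*2.+1].

Lemma monic_sqrX_sub1 (F : fieldType) : ('X^2 - 1 : {poly F}) \is monic.
Proof. exact: monicXnsubC. Qed.

Lemma size_sqrX_sub1 (F : fieldType) k : size (('X^2 - 1) ^+ k : {poly F}) = k.*2.+1.
Proof.
rewrite polySpred ?size_exp ?size_XnsubC ?mul2n //.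
by rewrite monic_neq0 ?monic_exp ?monic_sqrX_sub1.
Qed.

Lemma skewrec_spanX (F : fieldType) m (f : {poly F}) :
  skewrec_span m f -> skewrec_span m.+1 ('X * f).
Proof.
case=> c ->; exists (fun k => if (k < m.+1)%N then c k else 0).
rewrite [RHS]big_ord_recr /= ltnn scale0r addr0 mulr_sumr; apply: eq_bigr => k _.
by rewrite ltn_ord -scalerAr mulrA -exprS subSn // -ltnS.
Qed.

Lemma skewrec_span_sqrX_sub1 (F : fieldType) m (f : {poly F}) :
  skewrec_span m f -> skewrec_span m.+1 (('X^2 - 1) * f).
Proof.
case=> c ->; exists (fun k => if k is j.+1 then c j else 0).
rewrite [RHS]big_ord_recl /= scale0r add0r mulr_sumr; apply: eq_bigr => k _.
by rewrite -scalerAr mulrCA -exprS /bump /= add1n subSS.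
Qed.

Lemma skewrec_spanD (F : fieldType) m (f g : {poly F}) :
  skewrec_span m f -> skewrec_span m g -> skewrec_span m (f + g).
Proof.
case=> c -> [d ->]; exists (fun k => c k + d k).
by rewrite -big_split; apply: eq_bigr => k _; rewrite scalerDl.
Qed.

Lemma skewrec_spanZ (F : fieldType) m a (f : {poly F}) :
  skewrec_span m f -> skewrec_span m (a *: f).
Proof.
case=> c ->; exists (fun k => a * c k).
by rewrite scaler_sumr; apply: eq_bigr => k _; rewrite scalerA.
Qed.

Lemma skewrec_spanM (F : fieldType) m n (f g : {poly F}) :
  skewrec_span m f -> skewrec_span n g -> skewrec_span (m + n) (f * g).
Proof.
case=> c -> sg; rewrite mulr_suml.
pose P (h : {poly F}) := skewrec_span (m + n) h.
apply: (big_ind P) => [|u v|k _]; rewrite /P.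
- exists (fun _ => 0); rewrite big1 // => k _; exact: scale0r.
- exact: skewrec_spanD.
rewrite -scalerAl; apply: skewrec_spanZ; rewrite -mulrA.
have -> : (m + n = (m - k) + (k + n))%N by rewrite addnA subnK // -ltnS.
elim: (m - k)%N => [|j IHj]; last first.
  by rewrite exprS -mulrA addSn; apply: skewrec_spanX.
rewrite expr0 mul1r add0n; elim: (k : nat) => [|j IHj]; first by rewrite expr0 mul1r.
by rewrite exprS -mulrA addSn; apply: skewrec_span_sqrX_sub1.
Qed.

Lemma skewrecM (F : fieldType) m n (f g : {poly F}) :
  skewrec m f -> skewrec n g -> skewrec (m + n) (f * g).
Proof.
move=> [sf mf zf] [sg mg zg]; split; [exact: skewrec_spanM | by rewrite monicMl|].
by rewrite size_monicM ?monic_neq0 // zf zg doubleD addSn addnS.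
Qed.

Lemma skewrec0 (F : fieldType) : skewrec 0 (1 : {poly F}).
Proof.
split; rewrite ?monic1 ?size_poly1 //.
by exists (fun _ => 1); rewrite big_ord1 scale1r !expr0 mulr1.
Qed.

Lemma skewrec1 (F : fieldType) (b : F) : b != 0 ->
  skewrec 1 (('X - b%:P) * ('X - (- b^-1)%:P)).
Proof.
move=> b0; split; try first [by rewrite monicMl ?monicXsubC |
  by rewrite size_monicM ?monicXsubC ?polyXsubC_eq0 // !size_XsubC].
exists (fun k => if k is 0 then b^-1 - b else 1).
rewrite big_ord_recl big_ord1 /= scale1r expr0 expr1 mulr1 mul1r -mul_polyC polyCB.
have : b%:P * b^-1%:P = 1 :> {poly F} by rewrite -polyCM mulfV.
rewrite rmorphN /= => bb; rewrite expr2 /bump /= expr1 -bb; ring.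
Qed.

Lemma skewrec_coef (F : fieldType) m (f : {poly F}) : skewrec m f ->
  exists c : nat -> F, c m = 1 /\
    f = \sum_(k < m.+1) c k *: ('X^(m - k) * ('X^2 - 1) ^+ k).
Proof.
move=> [[c fE] mf sf]; exists c; split=> //.
have := monicP mf; rewrite lead_coefE sf /= fE coef_sum big_ord_recr /= big1 ?add0r.
  rewrite coefZ subnn expr0 mul1r.
  have /monicP : ('X^2 - 1 : {poly F}) ^+ m \is monic by rewrite monic_exp ?monic_sqrX_sub1.
  by rewrite lead_coefE size_sqrX_sub1 /= => ->; rewrite mulr1.
move=> k _; rewrite coefZ nth_default ?mulr0 //.
rewrite (leq_trans (size_polyMleq _ _)) // size_polyXn size_sqrX_sub1 /=.
by have := ltn_ord k; lia.
Qed.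

Lemma skewrec_horner0 (F : fieldType) m (f : {poly F}) : skewrec m f -> f.[0] = (-1) ^+ m.
Proof.
case/skewrec_coef => c [cm ->]; rewrite horner_sum big_ord_recr /= big1 ?add0r.
  by rewrite cm scale1r subnn mul1r !(hornerE, horner_exp) expr0n /= sub0r.
move=> k _; rewrite hornerZ hornerM hornerXn expr0n subn_eq0 leqNgt ltn_ord.
by rewrite mul0r mulr0.
Qed.

Lemma skewrec_Xn_add (F : fieldType) m (c : F) (s : {poly F}) :
  skewrec m s -> skewrec m.+1 (c *: 'X^(m.+1) + ('X^2 - 1) * s).
Proof.
move=> [ss ms zs].
have mQ : ('X^2 - 1) * s \is monic by rewrite monicMl ?monic_sqrX_sub1.
have zQ : size (('X^2 - 1) * s) = m.+1.*2.+1.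
  by rewrite size_monicM ?monic_sqrX_sub1 ?monic_neq0 // -[_ - 1]expr1 size_sqrX_sub1 zs.
have ltz : (size (c *: 'X^(m.+1))%R < size (('X^2 - 1) * s)%R)%N.
  by rewrite zQ ltnS (leq_trans (size_scale_leq _ _)) // size_polyXn; lia.
split; last by rewrite addrC size_polyDl.
- apply: skewrec_spanD; last exact: skewrec_span_sqrX_sub1.
  apply: skewrec_spanZ; elim: m.+1 => [|n IHn]; last by rewrite exprS; apply: skewrec_spanX.
  by rewrite expr0; case: (skewrec0 F).
- by rewrite monicE lead_coefDr.
Qed.

(** The recursion on m divides by t^2 - 1: subtracting g(1) times a power of t
    from g leaves a multiple of t - 1, and this term is the odd part of
    (t - b) c t^(m+1) for a suitable constant c, which depends on the parity
    of m. *)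
Lemma skewrec_odd_part (F : fieldType) m (g : {poly F}) (b : F) :
  b != 0 -> g \is monic -> size g = m.+1 ->
  exists s h : {poly F}, [/\ skewrec m s, (size h <= m.+1)%N &
    ('X - b%:P) * s = 'X * (g \Po 'X^2) + (h \Po 'X^2)].
Proof.
move=> b0; elim: m g => [|m IHm] g mg sg.
  have -> : g = 1.
    by have := monicP mg; rewrite lead_coefE sg /= => g0; rewrite [g]size1_polyC ?sg // g0.
  exists 1, (- b)%:P; split; [exact: skewrec0 | by rewrite size_polyC leq_b1|].
  by rewrite !comp_polyC polyCN polyC1 !mulr1.
pose r := g.[1] *: 'X^((m.+1)./2).
have [g1 gE] : exists g1, g - r = g1 * ('X - 1%:P).
  by apply/factor_theorem; rewrite rootE !hornerE expr1n mulr1 subrr.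
have ltr : (size (- r)%R < size g)%N.
  rewrite size_polyN sg ltnS (leq_trans (size_scale_leq _ _)) // size_polyXn; lia.
have mg1 : g1 \is monic.
  by rewrite -(monicMr _ (monicXsubC 1)) -gE monicE lead_coefDl.
have sg1 : size g1 = m.+1.
  have := size_polyDl ltr; rewrite gE size_monicM ?polyXsubC_eq0 // size_XsubC sg.
  by rewrite addn2 => -[].
have [s1 [h1 [ss1 sh1 sE1]]] := IHm g1 mg1 sg1.
pose c := if odd m.+1 then - b^-1 * g.[1] else g.[1].
pose h2 := if odd m.+1 then c *: 'X^((m.+2)./2) else (- b * c) *: 'X^((m.+1)./2).
have cE : c *: (('X - b%:P) * 'X^(m.+1)) = 'X * (r \Po 'X^2) + (h2 \Po 'X^2).
  have sqr k : ('X^k : {poly F}) \Po 'X^2 = 'X^k * 'X^k.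
    by rewrite comp_Xn_poly -exprM -exprD mul2n addnn.
  rewrite /r /h2 /c; set k := (m.+1)./2.
  case: ifP => odd_m; rewrite !comp_polyZ !sqr -!mul_polyC.
    have -> : (m.+2)./2 = k.+1 by rewrite /k; lia.
    have -> : ('X^(m.+1) : {poly F}) = 'X * ('X^k * 'X^k).
      by rewrite -exprD -exprS; congr ('X^_); rewrite /k; lia.
    have BB : b%:P * b^-1%:P = 1 :> {poly F} by rewrite -polyCM mulfV.
    by rewrite polyCM polyCN exprS; ring: BB.
  have -> : ('X^(m.+1) : {poly F}) = 'X^k * 'X^k.
    by rewrite -exprD; congr ('X^_); rewrite /k; lia.
  by rewrite polyCM polyCN; ring.
exists (c *: 'X^(m.+1) + ('X^2 - 1) * s1), (h1 * ('X - 1) + h2); split.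
- exact: skewrec_Xn_add.
- apply: leq_trans (size_polyD _ _) _; rewrite geq_max; apply/andP; split.
    have [->|h10] := eqVneq h1 0; first by rewrite mul0r size_poly0.
    by rewrite size_Mmonic ?monicXsubC // size_XsubC addn2 /= ltnS.
  by rewrite /h2; case: ifP => _; rewrite (leq_trans (size_scale_leq _ _)) // size_polyXn; lia.
rewrite mulrDr -scalerAr cE mulrCA sE1.
have -> : g = g1 * ('X - 1%:P) + r by rewrite -gE subrK.
rewrite !(comp_polyD, comp_polyM, comp_polyB, comp_polyX, comp_polyC) !polyC1; ring.
Qed.

(** * Products of an involution and a U2-matrix *)

(** Invertibility of V is implied. *)
Definition inv_U2 (F : fieldType) N (T : 'M[F]_N) :=
  exists S V : 'M[F]_N,
    [/\ S *m S = 1%:M, (V - 1%:M) *m (V - 1%:M) = 0 & T = S *m V].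

Lemma inv_U2_similar (F : fieldType) a b (M : 'M[F]_a) (T : 'M[F]_b) :
  mxsimilar M T -> inv_U2 T -> inv_U2 M.
Proof.
move=> [P [Q [PQ QP PM]]] [S [V [SS VV TE]]].
have conjM (X Y : 'M_b) : (Q *m X *m P) *m (Q *m Y *m P) = Q *m (X *m Y) *m P.
  by rewrite !mulmxA -[_ *m P *m Q]mulmxA PQ mulmx1.
exists (Q *m S *m P), (Q *m V *m P); split.
- by rewrite conjM SS mulmx1.
- have -> : Q *m V *m P - 1%:M = Q *m (V - 1%:M) *m P.
    by rewrite mulmxBr mulmxBl mulmx1 QP.
  by rewrite conjM VV mulmx0 mul0mx.
by rewrite conjM -TE -mulmxA -PM mulmxA QP mul1mx.
Qed.

(** These m polynomials and their products by t form a basis of F[t]/(s), for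
    s skew reciprocal of degree 2m.  They span t^(m-1) F[t - 1/t] in that
    quotient. *)
Definition skewrec_basis (F : fieldType) m : 'cV[{poly F}]_m :=
  \col_k ('X^(m.-1 - k) * ('X^2 - 1) ^+ k).

(** Modulo t^2 - 1 only the first term survives; its values at 1 and -1
    determine a 0 and b 0 because the characteristic is not 2. *)
Lemma skewrec_basis_sum0 (F : fieldType) (two_n0 : 2%:R != 0 :> F) m (a b : nat -> F) :
  \sum_(k < m) ((a k)%:P + (b k)%:P * 'X) * ('X^(m.-1 - k) * ('X^2 - 1) ^+ k) = 0 ->
  forall k, (k < m)%N -> a k = 0 /\ b k = 0.
Proof.
elim: m a b => // m IHm a b; rewrite big_ord_recl /= subn0 expr0 mulr1.
set u := _ * _ => E.
have tailE : \sum_(k < m) ((a k.+1)%:P + (b k.+1)%:P * 'X) *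
      ('X^(m.-1 - k) * ('X^2 - 1) ^+ k) * ('X^2 - 1) = - u.
  apply/eqP; rewrite -addr_eq0 addrC -[X in _ == X]E; apply/eqP; congr (_ + _).
  apply: eq_bigr => k _; rewrite /bump /= add1n [_ ^+ k.+1]exprSr.
  by rewrite (_ : m - k.+1 = m.-1 - k)%N ?mulrA //; have := ltn_ord k; lia.
rewrite -mulr_suml in tailE.
have u1 : a 0 + b 0 = 0.
  have := congr1 (fun f : {poly F} => f.[1]) tailE.
  rewrite /u !(hornerE, horner_exp) !expr1n subrr mulr0 !mulr1 => /esym/eqP.
  by rewrite oppr_eq0 => /eqP.
have u2 : a 0 - b 0 = 0.
  have := congr1 (fun f : {poly F} => f.[-1]) tailE.
  rewrite /u !(hornerE, horner_exp) sqrrN expr1n subrr mulr0 mulrN1 => /esym/eqP.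
  by rewrite oppr_eq0 mulf_eq0 expf_eq0 oppr_eq0 oner_eq0 andbF orbF => /eqP.
have b0 : b 0 = 0.
  have : 2%:R * b 0 = 0.
    have -> : 2%:R * b 0 = (a 0 + b 0) - (a 0 - b 0) by ring.
    by rewrite u1 u2 subrr.
  by move/eqP; rewrite mulf_eq0 (negPf two_n0) => /eqP.
have a0 : a 0 = 0 by move: u1; rewrite b0 addr0.
move: tailE; rewrite /u a0 b0 polyC0 mul0r addr0 mul0r oppr0 => /eqP.
rewrite mulf_eq0 (negPf (monic_neq0 (monic_sqrX_sub1 F))) orbF => /eqP tail0.
by case=> // k; rewrite ltnS; apply: (IHm (a \o succn) (b \o succn)).
Qed.

Lemma skewrec_basis_free (F : fieldType) (two_n0 : 2%:R != 0 :> F) m (s : {poly F})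
    (r1 r2 : 'rV[F]_m) : skewrec m s ->
  s %| ((Cmx r1 + 'X *: Cmx r2) *m skewrec_basis F m) 0 0 -> r1 = 0 /\ r2 = 0.
Proof.
move=> [_ ms ss]; rewrite mxE.
pose a (r : 'rV[F]_m) k := if insub k is Some i then r 0 i else 0.
rewrite (eq_bigr (fun k : 'I_m => ((a r1 k)%:P + (a r2 k)%:P * 'X) *
   ('X^(m.-1 - k) * ('X^2 - 1) ^+ k))); last first.
  by move=> k _; rewrite !mxE /a valK mulrC [_%:P * 'X]mulrC mulrC.
move=> dv; have /skewrec_basis_sum0 E : \sum_(k < m) ((a r1 k)%:P + (a r2 k)%:P * 'X) *
   ('X^(m.-1 - k) * ('X^2 - 1) ^+ k) = 0.
  apply/eqP; apply: contraTT dv => sum0; rewrite gtNdvdp //.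
  rewrite ss ltnS; apply: leq_trans (size_sum _ _ _) _; apply/bigmax_leqP => k _.
  apply: leq_trans (size_polyMleq _ _) _.
  have : (size ((a r1 k)%:P + (a r2 k)%:P * 'X)%R <= 2)%N.
    by rewrite addrC size_MXaddC; case: ifP => // _; rewrite ltnS size_polyC leq_b1.
  have szw : (size ('X^(m.-1 - k) * ('X^2 - 1) ^+ k : {poly F})%R <= m.-1 + k.+1)%N.
    apply: leq_trans (size_polyMleq _ _) _; rewrite size_polyXn size_sqrX_sub1.
    by have := ltn_ord k; lia.
  move=> szl; have := leq_add szl szw; case: (_ + _)%N => // n' /=.
  by have := ltn_ord k; lia.
by split; apply/rowP => k; rewrite mxE; have [] := E two_n0 k (ltn_ord k); rewrite /a valK.
Qed.

Lemma skewrec_basis_sqrX (F : fieldType) m (s : {poly F}) : skewrec m s ->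
  exists (D : 'M_m) (c : 'cV_m), 'X^2 *: skewrec_basis F m =
    skewrec_basis F m + 'X *: (Cmx D *m skewrec_basis F m) + s *: Cmx c.
Proof.
case/skewrec_coef => c [cm sE].
exists (\matrix_(k, j) if k == m.-1 :> nat then - c j else (k.+1 == j :> nat)%:R).
exists (\col_k (k == m.-1 :> nat)%:R); apply/colP => k; rewrite !mxE.
have m0 : (0 < m)%N := leq_ltn_trans (leq0n _) (ltn_ord k).
have [kE|kN] := eqVneq (k : nat) m.-1.
  pose w := \sum_(j < m) c j *: ('X^(m.-1 - j) * ('X^2 - 1) ^+ j).
  rewrite (eq_bigr (fun j : 'I_m => - (c j *: ('X^(m.-1 - j) * ('X^2 - 1) ^+ j)))); last first.
    by move=> j _; rewrite !mxE kE eqxx polyCN mulNr mul_polyC.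
  have -> : s = 'X * w + ('X^2 - 1) * ('X^2 - 1) ^+ m.-1.
    rewrite sE big_ord_recr /= cm scale1r subnn expr0 mul1r -exprS prednK //.
    congr (_ + _); rewrite mulr_sumr; apply: eq_bigr => j _.
    rewrite -scalerAr mulrA -exprS; congr (_ *: ('X^_ * _)).
    by have := ltn_ord j; lia.
  by rewrite sumrN -/w kE subnn expr0 ?eqxx /= ?polyC1; ring.
have ltk : (k.+1 < m)%N by have := ltn_ord k; move/eqP: kN; lia.
rewrite mulr0 addr0 (bigD1 (Ordinal ltk)) //= big1 ?addr0.
  rewrite !mxE (negPf kN) eqxx mul1r.
  have -> : (m.-1 - k = (m.-1 - k.+1).+1)%N by lia.
  by rewrite /= ['X^((_ - _).+1)]exprS [_ ^+ k.+1]exprS; ring.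
move=> j jk; rewrite !mxE (negPf kN) (_ : _ == _ = false) ?mul0r //.
by apply: contraNF jk => /eqP e; apply/eqP/val_inj.
Qed.

Lemma skewrec_basis_Xn (F : fieldType) m (s : {poly F}) : skewrec m s ->
  exists (al : 'rV_m) (ka : F),
    ('X^m)%:M = 'X *: (Cmx al *m skewrec_basis F m) + s *: (ka%:P)%:M :> 'M_1.
Proof.
case: m => [|m] ss.
  exists 0, 1; case/skewrec_coef: ss => c [c0 ->].
  by rewrite big_ord1 c0 !expr0 scale1r mulr1 scale1r map_mx0 mul0mx scaler0 add0r.
exists (delta_mx 0 0), 0; rewrite polyC0 raddf0 scaler0 addr0 map_delta_mx -rowE.
by apply/matrixP => u v; rewrite !ord1 !mxE /= subn0 expr0 mulr1 -exprS.
Qed.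

(** With w the basis attached to s, use the basis of F[t]/(p) made of z = t^m,
    a = (t - e) w, b = t a and, if k = 1, of z' = (t - e) s.  Let S exchange a
    and b and multiply z and z' by e and e'.  Then t a = b, while t b - a and
    t z - e z are combinations of b and z'; so S^-1 t - 1 maps z and a into
    the span of b and z', and kills b and z'. *)
Lemma inv_U2_model (F : fieldType) (two_n0 : 2%:R != 0 :> F) m k (s : {poly F}) (e e' : F) :
  e ^+ 2 = 1 -> e' ^+ 2 = 1 -> (k <= 1)%N -> skewrec m s ->
  exists (T : 'M_((1 + m) + (m + k))) x, inv_U2 T /\
    model (('X - e%:P) * s * ('X - e'%:P) ^+ k) T x.
Proof.
move=> e2 e'2 k1 ss; set p := _ * _ ^+ k; set tau := ('X - e%:P) * s.
have [al [ka zE]] := skewrec_basis_Xn ss.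
have [D [c wE]] := skewrec_basis_sqrX ss.
set w := skewrec_basis F m in zE wE.
pose z : 'cV[{poly F}]_1 := ('X^m)%:M.
pose a := ('X - e%:P) *: w; pose b := 'X *: a.
pose z' : 'cV[{poly F}]_k := const_mx tau.
pose u : 'rV[F]_k := const_mx 1.
have [q1 tauE] : exists q1, tau%:M = Cmx u *m z' + p *: q1 :> 'M_1.
  case: k k1 @p @z' @u => [|[|//]] _ p z' u.
    by exists 1%:M; rewrite [u]thinmx0 map_mx0 mul0mx add0r scale_scalar_mx mulr1 /p expr0 mulr1.
  exists 0; rewrite scaler0 addr0; apply/matrixP => r r'; rewrite !ord1 !mxE big_ord1.
  by rewrite !mxE polyC1 mul1r.
have [q2 z'E] : exists q2, 'X *: z' = (e'%:P) *: z' + p *: q2.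
  case: k k1 @p @z' @u q1 tauE => [|[|//]] _ p z' u q1 tauE.
    by exists 0; rewrite [z']flatmx0 !scaler0 addr0.
  exists (const_mx 1); apply/matrixP => r r'; rewrite !mxE /p expr1 -/tau; ring.
pose S11 : 'M[F]_(1 + m) := block_mx e%:M 0 0 0.
pose S12 : 'M[F]_(1 + m, m + k) := block_mx 0 0 1%:M 0.
pose S21 : 'M[F]_(m + k, 1 + m) := block_mx 0 1%:M 0 0.
pose S22 : 'M[F]_(m + k) := block_mx 0 0 0 e'%:M.
pose N : 'M[F]_(1 + m, m + k) := block_mx (e *: al) (e * ka *: u) D (c *m u).
pose S := block_mx S11 S12 S21 S22.
pose V := block_mx 1%:M N 0 1%:M.
pose x := col_mx (col_mx z a) (col_mx b z').
exists (S *m V), x; split.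
  exists S, V; split=> //.
    rewrite /S mulmx_block /S11 /S12 /S21 /S22 !mulmx_block !add_block_mx.
    rewrite !(mul0mx, mulmx0, mulmx1, mul1mx, addr0, add0r) -!scalar_mxM -!expr2 e2 e'2.
    by rewrite !block_mx0 -!scalar_mx_block.
  rewrite /V [X in _ - X]scalar_mx_block opp_block_mx add_block_mx !subrr !oppr0 !addr0 mulmx_block.
  by rewrite !(mul0mx, mulmx0, addr0) block_mx0.
split.
- have szXe (f : F) : ('X - f%:P) \is monic := monicXsubC f.
  case: ss => _ ms sz; rewrite /p size_monicM ?monic_neq0 ?monicMl ?monic_exp //.
  rewrite size_monicM ?monic_neq0 // sz size_XsubC.
  have -> : size (('X - e'%:P) ^+ k) = k.+1.
    by rewrite polySpred ?size_exp ?size_XsubC ?mul1n // monic_neq0 ?monic_exp.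
  by lia.
- move=> r; rewrite -[r]hsubmxK -[lsubmx r]hsubmxK -[rsubmx r]hsubmxK.
  move: (lsubmx (lsubmx r)) (rsubmx (lsubmx r)) (lsubmx (rsubmx r)) (rsubmx (rsubmx r)).
  move=> r1 ra rb r4; rewrite !map_row_mx !mul_row_col.
  set W := ((Cmx ra + 'X *: Cmx rb) *m w) 0 0; set y4 := \sum_j r4 0 j.
  have -> : (Cmx r1 *m z + Cmx ra *m a + (Cmx rb *m b + Cmx r4 *m z')) 0 0 =
      (r1 0 0)%:P * 'X^m + ('X - e%:P) * (W + y4%:P * s).
    have -> : Cmx r1 *m z + Cmx ra *m a + (Cmx rb *m b + Cmx r4 *m z') =
       'X^m *: Cmx r1 + ('X - e%:P) *: ((Cmx ra + 'X *: Cmx rb) *m w) + Cmx r4 *m z'.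
      rewrite /z mul_mx_scalar /b /a -!scalemxAr scalerA [in RHS]mulmxDl -scalemxAl.
      by rewrite scalerDr scalerA [_ * 'X]mulrC !addrA.
    rewrite mxE [X in X + _]mxE [X in _ + X + _]mxE -/W [X in X + _ + _]mxE.
    rewrite (_ : (Cmx r4 *m z') 0 0 = y4%:P * tau); last first.
      by rewrite mxE /y4 rmorph_sum mulr_suml; apply: eq_bigr => j _; rewrite !mxE.
    rewrite !mxE /tau; ring.
  move=> pd; have e0 : e != 0.
    by apply: contra_eq_neq e2 => ->; rewrite expr0n eq_sym oner_eq0.
  have r10 : r1 0 0 = 0.
    have : ('X - e%:P) %| p by rewrite /p -mulrA dvdp_mulIl.
    move/dvdp_trans/(_ pd); rewrite dvdp_XsubCl rootE !hornerE subrr mul0r addr0.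
    by rewrite mulf_eq0 expf_eq0 (negPf e0) andbF orbF => /eqP.
  move: pd; rewrite r10 polyC0 mul0r add0r /p -mulrA dvdp_mul2l ?polyXsubC_eq0 // => pd.
  have [ra0 rb0] : ra = 0 /\ rb = 0.
    apply: (skewrec_basis_free two_n0 ss); rewrite -/w -/W.
    by rewrite -(dvdp_addl (n := y4%:P * s)) ?dvdp_mull // (dvdp_trans _ pd) // dvdp_mulIl.
  have r1E : r1 = 0 by apply/rowP => j; rewrite !ord1 r10 mxE.
  suff -> : r4 = 0 by rewrite r1E ra0 rb0 !row_mx0.
  have W0 : W = 0 by rewrite /W ra0 rb0 !map_mx0 scaler0 addr0 mul0mx mxE.
  have [k0|k_gt0] := posnP k.
    by apply/rowP => j; have := ltn_ord j; lia.
  have kE : k = 1%N by lia.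
  move: pd; rewrite W0 add0r mulrC [X in _ ^+ X]kE expr1.
   rewrite dvdp_mul2r; last by case: ss => _ /monic_neq0.
  have [y0 _|y0] := eqVneq y4 0; last first.
    by rewrite gtNdvdp ?polyC_eq0 // size_XsubC size_polyC y0.
  apply/rowP => j; rewrite mxE -[RHS]y0 /y4 (bigD1 j) //= big1 ?addr0 // => l.
  by case/eqP; apply: val_inj; have := ltn_ord l; have := ltn_ord j; rewrite /=; lia.
have Vx : Cmx V *m x = col_mx (col_mx (z + Cmx (e *: al) *m b + Cmx (e * ka *: u) *m z')
    (a + Cmx D *m b + Cmx (c *m u) *m z')) (col_mx b z').
  rewrite map_block_mx mul_block_col !map_mx1 map_mx0 !mul1mx mul0mx add0r.
  by rewrite map_block_mx mul_block_col add_col_mx !addrA.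
have Tx : Cmx (S *m V) *m x =
       col_mx (col_mx (e%:P *: (z + Cmx (e *: al) *m b + Cmx (e * ka *: u) *m z')) b)
    (col_mx (a + Cmx D *m b + Cmx (c *m u) *m z') (e'%:P *: z')).
  rewrite map_mxM -mulmxA Vx /S map_block_mx mul_block_col.
  rewrite /S11 /S12 /S21 /S22 !map_block_mx !mul_block_col !map_mx0 !map_mx1 !map_scalar_mx.
  by rewrite !mul0mx !mul1mx !mul_scalar_mx !(addr0, add0r) !add_col_mx !(addr0, add0r).
exists (col_mx (col_mx (ka%:P *: q1) 0) (col_mx (Cmx c *m q1) q2)).
rewrite Tx !scale_col_mx !add_col_mx; congr (col_mx (col_mx _ _) (col_mx _ _)).
- have -> : 'X *: z = e%:P *: z + (Cmx al *m b + ka%:P *: tau%:M).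
    rewrite -[in LHS](subrK e%:P 'X) scalerDl addrC; congr (_ + _).
    rewrite {1}/z zE /b /a -!scalemxAr !scalerDr !scalerA !scale_scalar_mx [_ * 'X]mulrC.
    by rewrite -/tau [tau * _]mulrC.
  rewrite tauE -addrA !scalerDr !map_mxZ -!scalemxAl !scalerA /= -!polyCM.
  by rewrite [e * (e * _)]mulrA -expr2 e2 mul1r polyC1 scale1r [p * ka%:P]mulrC !addrA.
- by rewrite scaler0 addr0.
- rewrite -addrA; have -> : Cmx (c *m u) *m z' + p *: (Cmx c *m q1) = tau *: Cmx c.
    by rewrite map_mxM -mulmxA scalemxAr -mulmxDr -tauE mul_mx_scalar.
  have -> : 'X *: b = ('X - e%:P) *: ('X^2 *: w).
    by rewrite /b /a !scalerA; congr (_ *: _); ring.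
  by rewrite wE !scalerDr !scalerA -!scalemxAr scalerA [_ * 'X]mulrC /a -addrA.
exact: z'E.
Qed.

(** * Quadratic models *)

Lemma sum_pairs_size (F : fieldType) (q : nat -> {poly F}) d (a b : nat -> F) :
  (forall k, size (q k) = k.*2.+1) ->
  (size (\sum_(k < d) ((a k)%:P + (b k)%:P * 'X) * q k)%R <= d.*2)%N.
Proof.
move=> sq; apply: leq_trans (size_sum _ _ _) _; apply/bigmax_leqP => k _.
apply: leq_trans (size_polyMleq _ _) _.
have : (size ((a k)%:P + (b k)%:P * 'X)%R <= 2)%N.
  by rewrite addrC size_MXaddC; case: ifP => // _; rewrite ltnS size_polyC leq_b1.
by rewrite sq addnS /=; have := ltn_ord k; lia.
Qed.

(** The degrees 2k and 2k + 1 of q k and t q k are pairwise distinct. *)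
Lemma sum_pairs_free (F : fieldType) (q : nat -> {poly F}) d (a b : nat -> F) :
  (forall k, size (q k) = k.*2.+1) ->
  \sum_(k < d) ((a k)%:P + (b k)%:P * 'X) * q k = 0 ->
  forall k, (k < d)%N -> a k = 0 /\ b k = 0.
Proof.
move=> sq; elim: d => // d IHd; rewrite big_ord_recr /=.
set u := \sum_(_ < d) _; set l := (a d)%:P + _ => E.
have l0 : l = 0.
  apply: contraTeq isT => l0; have lq : l * q d = - u.
    by apply/eqP; rewrite -addr_eq0 addrC E.
  have := sum_pairs_size d a b sq; rewrite -/u -size_polyN -lq.
  rewrite size_mul //; last by rewrite -size_poly_gt0 sq.
  by rewrite sq addnS /= -[leqRHS]add0n leq_add2r leqn0 size_poly_eq0 (negPf l0).
move: E; rewrite l0 mul0r addr0 => /IHd u0 k; rewrite ltnS leq_eqVlt => /predU1P[->|/u0 //].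
have [] : l`_0 = 0 /\ l`_1 = 0 by rewrite l0 !coef0.
by rewrite /l !coefD !coefC !coefMX !coefC /= addr0 add0r.
Qed.

(** The third condition makes [[0, 1], [B, Y]] the matrix of the multiplication
    by t in the family (e, t e), which is free by the fourth one.  The last two
    conditions on p and e, that p is prime to t and that the span of e contains
    a power of t modulo p, are what allows models to be concatenated. *)
Definition quad_model (F : fieldType) n (B : 'M[F]_n) (p : {poly F}) (e : 'cV[{poly F}]_n) :=
  [/\ size p = n.*2.+1, p.[0] != 0,
      exists Y q, 'X^2 *: e = Cmx B *m e + 'X *: (Cmx Y *m e) + p *: q,
      forall r1 r2 : 'rV_n, p %| ((Cmx r1 + 'X *: Cmx r2) *m e) 0 0 -> r1 = 0 /\ r2 = 0 &
      exists k al q, ('X^k)%:M = Cmx al *m e + p *: q :> 'M_1].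

Lemma comp_sqrX_sum (F : fieldType) (h : {poly F}) d : (size h <= d)%N ->
  h \Po 'X^2 = \sum_(j < d) h`_j *: 'X^(2 * j).
Proof.
move=> sh; rewrite comp_polyE (big_ord_widen _ (fun j => h`_j *: 'X^2 ^+ j) sh) big_mkcond.
apply: eq_bigr => j _; rewrite -exprM; case: ltnP => // lehj.
by rewrite nth_default ?scale0r.
Qed.

(** For a = 0 these would be the powers of t^2, which only give models
    whose p has a prescribed even part.  The factor t - a makes a a root of p
    and turns this into a condition on the odd part of p / (t - a). *)
Definition companion_basis (F : fieldType) (a : F) k : {poly F} :=
  if k is j.+1 then 'X^((2 * j).+1) * ('X - a%:P) else 1.

Lemma size_companion_basis (F : fieldType) (a : F) k :
  size (companion_basis a k) = k.*2.+1.
Proof.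
case: k => [|k]; rewrite /companion_basis ?size_poly1 //.
by rewrite size_Mmonic ?monicXsubC ?monic_neq0 ?monicXn // size_polyXn size_XsubC mul2n addn2.
Qed.

(** In the basis q, multiplication by t^2 is the shift q k |-> q (k+1), up to
    a multiple of t.  So p must be congruent to f(q), that is, to the sum of the
    f_j q j, modulo the span of the t q j.  After division by t - a this
    prescribes the odd part of (t - b) s, which is possible by
    [skewrec_odd_part]; the constant terms agree by the hypothesis on a b.
    The relation holds exactly, with a constant multiple of p, which is needed to
    concatenate models. *)
Lemma companion_quad_model (F : fieldType) (f : {poly F}) (a b : F) :
  f \is monic -> (1 < size f)%N -> a != 0 -> b != 0 ->
  f.[0] = a * b * (-1) ^+ (size f).-2 ->
  exists s, skewrec (size f).-2 s /\ exists (e : 'cV_(size f).-1) Y c al,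
    [/\ 'X^2 *: e = Cmx (companionmx f) *m e + 'X *: (Cmx Y *m e) +
                    (('X - a%:P) * ('X - b%:P) * s) *: Cmx c,
        forall r1 r2 : 'rV_(size f).-1,
          ('X - a%:P) * ('X - b%:P) * s %| ((Cmx r1 + 'X *: Cmx r2) *m e) 0 0 ->
          r1 = 0 /\ r2 = 0 &
        1%:M = Cmx al *m e :> 'M_1].
Proof.
move=> mf sf a0 b0; rewrite horner_coef0 => f0E.
set d := (size f).-1 in f0E *; have sfd : size f = d.+1 by rewrite prednK // ltnW.
have d0 : (0 < d)%N by rewrite -ltnS -sfd.
have fd : f`_d = 1 by have := monicP mf; rewrite lead_coefE sfd.
pose g := \poly_(j < d) f`_j.+1.
have sg : size g = d.-1.+1.
  by rewrite prednK // size_poly_eq // prednK // fd oner_eq0.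
have mg : g \is monic by rewrite monicE lead_coefE sg /= coef_poly ltn_predL d0 prednK // fd.
have [s [h [ss sh sE]]] := skewrec_odd_part b0 mg sg.
exists s; split=> //; set p := _ * s.
pose q := companion_basis a.
have h0 : - a * h`_0 = f`_0.
  have := congr1 (fun r : {poly F} => r.[0]) sE.
  rewrite !(hornerE, horner_comp) (skewrec_horner0 ss) expr0n /=.
  by rewrite horner_coef0 f0E => <-; ring.
rewrite prednK // in sh.
have pE : p = q d + \sum_(j < d) f`_j *: q j + 'X * \sum_(j < d) h`_j *: q j.
  have -> : q d + \sum_(j < d) f`_j *: q j = (f`_0)%:P + \sum_(j < d) f`_j.+1 *: q j.+1.
    have sumE : \sum_(j < d.+1) f`_j *: q j = q d + \sum_(j < d) f`_j *: q j.
      by rewrite big_ord_recr /= fd scale1r addrC.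
    by rewrite -sumE big_ord_recl /= alg_polyC.
  have -> : 'X * \sum_(j < d) h`_j *: q j = ('X - a%:P) * (h \Po 'X^2) + (a * h`_0)%:P.
    rewrite (comp_sqrX_sum sh); case: (d) d0 => // d' _.
    rewrite !big_ord_recl /= expr0 mulrDr mulrDr !mulr_sumr -addrA [_ + (a * _)%:P]addrC addrA.
    congr (_ + _); first by rewrite -!mul_polyC polyCM; ring.
    apply: eq_bigr => j _; rewrite /bump /= add1n -!scalerAr; congr (_ *: _).
    by rewrite mulrA -exprS mulrC mulnS.
  have -> : \sum_(j < d) f`_j.+1 *: q j.+1 = 'X * ('X - a%:P) * (g \Po 'X^2).
    rewrite (@comp_sqrX_sum _ _ d); last by rewrite sg prednK.
    rewrite mulr_sumr; apply: eq_bigr => j _.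
    by rewrite coef_poly ltn_ord -scalerAr /q /= mulrAC -exprS.
  by rewrite -h0 /p -[LHS]mulrA sE !polyCM polyCN; ring.
pose e : 'cV_d := \col_k q k.
pose Y : 'M_d := \matrix_(k, j)
    (a *+ ((k == 0 :> nat) && (j == 0 :> nat)) - h`_j *+ (k == d.-1 :> nat)).
exists e, Y, (\col_k (k == d.-1 :> nat)%:R), (\row_j (j == 0 :> nat)%:R); split.
- have sqr k : 'X^2 * q k = q k.+1 + (a *: 'X) *+ (k == 0).
    case: k => [|k]; rewrite /q /= ?mulr1n ?mulr0n -?mul_polyC; first by rewrite muln0; ring.
    by rewrite mulnS !exprS; ring.
  have Ye (k : 'I_d) : (Cmx Y *m e) k 0 =
      (a *+ (k == 0 :> nat))%:P - (\sum_(j < d) h`_j *: q j) *+ (k == d.-1 :> nat).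
    rewrite mxE -sumrMnl.
    have -> : (a *+ (k == 0 :> nat))%:P =
        \sum_(j < d) (a *+ ((k == 0 :> nat) && (j == 0 :> nat)))%:P * q j.
      rewrite (bigD1 (Ordinal d0)) //= andbT mulr1 big1 ?addr0 // => j.
      by rewrite -val_eqE /= => /negPf->; rewrite andbF mulr0n polyC0 mul0r.
    rewrite -sumrB; apply: eq_bigr => j _; rewrite !mxE polyCB mulrBl.
    by rewrite [(h`_j *+ _)%:P]polyCMn mulrnAl -mul_polyC.
  apply/colP => k; rewrite mxE [e k 0]mxE [in RHS]mxE [X in X + _]mxE sqr.
  rewrite [X in _ + X + _]mxE Ye [X in _ + _ + X]mxE !mxE.
  case: (eqVneq (k : nat) d.-1) => kd.
    have -> : \sum_j Cmx (companionmx f) k j * e j 0 = - \sum_(j < d) f`_j *: q j.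
      by rewrite -sumrN; apply: eq_bigr => j _; rewrite !mxE kd eqxx polyCN mulNr mul_polyC.
    rewrite [p in RHS]pE kd prednK // polyC1 !mulr1n.
    move: (\sum_(j < d) f`_j *: q j) (\sum_(j < d) h`_j *: q j) => Sf Sh.
    have id1 (r A x u v : {poly F}) : r + A * x = - u + x * (A - v) + (r + u + x * v) * 1.
      by ring.
    have id2 (r x u v : {poly F}) : r + 0 = - u + x * (0 - v) + (r + u + x * v) * 1.
      by ring.
    case: (_ == 0%N); rewrite ?mulr1n ?mulr0n -?mul_polyC ?polyC0; [exact: id1 | exact: id2].
  have ltk : (k.+1 < d)%N by have := ltn_ord k; move/eqP: kd; lia.
  rewrite (bigD1 (Ordinal ltk)) //= big1 ?addr0 => [|j jk]; last first.
    rewrite !mxE (negPf kd) (_ : _ == _ = false) ?mul0r //.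
    by apply: contraNF jk => /eqP jE; apply/eqP/val_inj.
  rewrite !mxE (negPf kd) eqxx polyC1 polyC0 mul1r mulr0n.
  rewrite mulr0 addr0 subr0; congr (_ + _).
  by case: (_ == 0%N); rewrite ?mulr1n ?mulr0n ?polyC0 ?mulr0 // -mul_polyC mulrC.
- move=> r1 r2; rewrite mxE.
  pose co (r : 'rV[F]_d) k := if insub k is Some i then r 0 i else 0.
  rewrite (eq_bigr (fun k : 'I_d => ((co r1 k)%:P + (co r2 k)%:P * 'X) * q k)); last first.
    by move=> k _; rewrite !mxE /co valK [_%:P * 'X]mulrC.
  move=> dv; have sum0 : \sum_(k < d) ((co r1 k)%:P + (co r2 k)%:P * 'X) * q k = 0.
    apply/eqP; apply: contraTT dv => sum0; rewrite gtNdvdp //.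
    apply: leq_ltn_trans (sum_pairs_size _ _ _ (size_companion_basis a)) _.
    case: ss => _ ms szs; rewrite size_Mmonic ?mulf_neq0 ?polyXsubC_eq0 //.
    by rewrite size_Mmonic ?polyXsubC_eq0 ?monicXsubC // !size_XsubC szs; lia.
  have E := sum_pairs_free (size_companion_basis a) sum0.
  by split; apply/rowP => k; rewrite mxE; have [] := E k (ltn_ord k); rewrite /co valK.
apply/matrixP => i i'; rewrite !ord1 !mxE eqxx.
rewrite (bigD1 (Ordinal d0)) //= big1 ?addr0 => [|j]; first by rewrite !mxE /= mulr1.
by rewrite !mxE -val_eqE /= => /negPf->; rewrite mul0r.
Qed.

Lemma coprimep_Xn (F : fieldType) (p : {poly F}) k : p.[0] != 0 -> coprimep p 'X^k.
Proof. by move=> p0; apply: coprimep_expr; rewrite coprimepX rootE. Qed.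

(** The relation of the first block has a remainder p1 c1 with c1 constant.
    Multiplied by t^(k+1) it becomes t c1 times p1 t^k, which modulo p1 p2 is a
    combination of the t p1 e2: the first block is linked to the second one
    through Y, without changing the block-diagonal matrix of the constant term. *)
Lemma quad_model_block (F : fieldType) d n (C : 'M[F]_d) (B : 'M[F]_n) (p1 p2 : {poly F})
    (e1 : 'cV[{poly F}]_d) (e2 : 'cV[{poly F}]_n) (Y1 : 'M_d) (c1 : 'cV_d) (al1 : 'rV_d) :
  size p1 = d.*2.+1 -> p1.[0] != 0 ->
  'X^2 *: e1 = Cmx C *m e1 + 'X *: (Cmx Y1 *m e1) + p1 *: Cmx c1 ->
  (forall r1 r2 : 'rV_d, p1 %| ((Cmx r1 + 'X *: Cmx r2) *m e1) 0 0 -> r1 = 0 /\ r2 = 0) ->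
  1%:M = Cmx al1 *m e1 :> 'M_1 ->
  quad_model B p2 e2 ->
  exists e, quad_model (block_mx C 0 0 B) (p1 * p2) e.
Proof.
move=> sp1 p10 rel1 free1 one1 [sp2 p20 [Y2 [q2 rel2]] free2 [k [al2 [qk powk]]]].
have p1n0 : p1 != 0 by rewrite -size_poly_eq0 sp1.
have p2n0 : p2 != 0 by rewrite -size_poly_eq0 sp2.
have swap N (r r' : {poly F}) (v : 'cV[{poly F}]_N) : r *: (r' *: v) = r' *: (r *: v).
  by rewrite !scalerA mulrC.
exists (col_mx ('X^(k.+1) *: e1) (p1 *: e2)); split.
- by rewrite size_mul // sp1 sp2 doubleD addnS.
- by rewrite hornerM mulf_neq0.
- exists (block_mx Y1 (c1 *m al2) 0 Y2), (col_mx ('X *: (Cmx c1 *m qk)) q2).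
  rewrite !map_block_mx !map_mx0 !mul_block_col !mul0mx addr0 !add0r.
  rewrite !scale_col_mx !add_col_mx; congr col_mx.
    have powE : Cmx al2 *m e2 = ('X^k)%:M - p2 *: qk by rewrite powk addrK.
    have linkE : Cmx (c1 *m al2) *m (p1 *: e2) =
        (p1 * 'X^k) *: Cmx c1 - (p1 * p2) *: (Cmx c1 *m qk).
      rewrite map_mxM -scalemxAr -mulmxA powE mulmxBr mul_mx_scalar scalerBr -[in LHS]scalemxAr.
      by rewrite !scalerA.
    rewrite swap rel1 linkE !scalerDr -!scalemxAr -!addrA; congr (_ + _).
    rewrite [_ *: ('X *: _)]swap; congr (_ + _).
    rewrite scalerN [X in - X + _]swap addNr addr0 !scalerA; congr (_ *: _).
    by rewrite exprS; ring.
  by rewrite swap rel2 !scalerDr -!scalemxAr [p1 *: (p2 *: _)]scalerA [p1 *: ('X *: _)]swap.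
- move=> r1 r2; rewrite -[r1]hsubmxK -[r2]hsubmxK.
  move: (lsubmx r1) (rsubmx r1) (lsubmx r2) (rsubmx r2) => a1 a2 b1 b2.
  rewrite !map_row_mx scale_row_mx add_row_mx mul_row_col -!scalemxAr.
  set W1 := _ *m e1; set W2 := _ *m e2; rewrite mxE [X in X + _]mxE [X in _ + X]mxE => dv.
  have [a10 b10] : a1 = 0 /\ b1 = 0.
    apply: free1; rewrite -/W1 -(Gauss_dvdpr _ (coprimep_Xn k.+1 p10)).
    rewrite -(dvdp_addl (n := p1 * W2 0 0)) ?dvdp_mulr //.
    by apply: dvdp_trans dv; rewrite dvdp_mulr.
  have [-> ->] : a2 = 0 /\ b2 = 0.
    apply: free2; rewrite -/W2 -(dvdp_mul2l _ _ p1n0).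
    by move: dv; rewrite /W1 a10 b10 map_mx0 scaler0 addr0 mul0mx mxE mulr0 add0r.
  by rewrite a10 b10 row_mx0.
exists k.+1, (row_mx al1 0), 0.
rewrite map_row_mx mul_row_col map_mx0 mul0mx addr0 scaler0 addr0 -scalemxAr -one1.
by rewrite scale_scalar_mx mulr1.
Qed.

Lemma quad_model_similar (F : fieldType) n m (A : 'M[F]_n) (B : 'M[F]_m) p e :
  n = m -> mxsimilar A B -> quad_model B p e -> exists e', quad_model A p e'.
Proof.
move=> nm [P [Q [PQ QP PA]]] [sp p0 [Y [q rel]] free [k [al [qk powk]]]].
have QB : Q *m B = A *m Q by rewrite -[A]mul1mx -QP -[Q *m P *m A]mulmxA PA -!mulmxA PQ mulmx1.
exists (Cmx Q *m e); split=> //; first by rewrite nm.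
- exists (Q *m Y *m P), (Cmx Q *m q); rewrite scalemxAr rel !mulmxDr -!scalemxAr !mulmxA.
  by rewrite -!map_mxM QB -[_ *m P *m Q]mulmxA PQ mulmx1.
- move=> r1 r2; rewrite mulmxA mulmxDl -scalemxAl -!map_mxM => /free[r1Q r2Q].
  by split; rewrite -[LHS]mulmx1 -QP mulmxA ?r1Q ?r2Q mul0mx.
exists k, (al *m P), qk; rewrite mulmxA -map_mxM -[_ *m P *m Q]mulmxA PQ mulmx1; exact: powk.
Qed.

Lemma mxsimilar_det (F : fieldType) n m (A : 'M[F]_n) (B : 'M[F]_m) :
  n = m -> mxsimilar A B -> \det A = \det B.
Proof.
move=> nm; rewrite -{m}nm in B * => -[P [Q [PQ QP PA]]].
rewrite -[A]mul1mx -QP -mulmxA PA !det_mulmx mulrC -mulrA.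
by rewrite -(det_mulmx P) PQ det1 mulr1.
Qed.

Lemma det_companionmx (F : fieldType) (f : {poly F}) : f \is monic ->
  f.[0] = (-1) ^+ (size f).-1 * \det (companionmx f).
Proof. by move=> mf; rewrite -char_poly_det companionmxK // horner_coef0. Qed.

Lemma quad_model0 (F : fieldType) (B : 'M[F]_0) : exists e, quad_model B 1 e.
Proof.
exists 0; split; rewrite ?size_poly1 ?hornerC ?oner_eq0 //.
- by exists 0, 0; rewrite [LHS]flatmx0 [RHS]flatmx0.
- by move=> r1 r2 _; rewrite [r1]thinmx0 [r2]thinmx0.
by exists 0, 0, 1%:M; rewrite mulmx0 add0r scale1r.
Qed.

(** A companion block is split off B.  Its model has the roots a and b1; the
    model of the remaining block is built with first root - 1 / b1. *)
Lemma quad_model_exists (F : fieldType) n (B : 'M[F]_n) (a : F) :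
  (0 < n)%N -> B \in unitmx -> a != 0 ->
  exists s e, skewrec n.-1 s /\
    quad_model B (('X - a%:P) * ('X - (- \det B / a)%:P) * s) e.
Proof.
have [N leN] := ubnP n; elim: N => // N IHN in n B a leN *.
case: n B leN => // n B; rewrite ltnS => leN _ uB a0.
have [f [m [B' [mf sf nE simB]]]] := rational_split B.
have detB := mxsimilar_det nE simB; rewrite det_ublock in detB.
set d := (size f).-1 in nE simB detB.
have d0 : (0 < d)%N by rewrite /d -ltnS prednK // ltnW.
have detB0 : \det B != 0 by move: uB; rewrite unitmxE unitfE.
have [detC0 detB'0] : \det (companionmx f) != 0 /\ \det B' != 0.
  by apply/andP; rewrite -negb_or -mulf_eq0 -detB.
pose b1 := - \det (companionmx f) / a.
have b10 : b1 != 0 by rewrite mulf_neq0 ?oppr_eq0 ?invr_eq0.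
have [|s1 [ss1 [e1 [Y1 [c1 [al1 [rel1 free1 one1]]]]]]] := companion_quad_model mf sf a0 b10.
  rewrite det_companionmx // -/d -/(d.-1).
  have -> : (-1) ^+ d = - (-1) ^+ d.-1 :> F by rewrite -[in LHS](prednK d0) exprS mulN1r.
  by rewrite /b1; field.
rewrite -/d in ss1; set p1 := _ * s1 in rel1 free1.
have sp1 : size p1 = d.*2.+1.
  case: ss1 => _ ms szs; rewrite size_Mmonic ?mulf_neq0 ?polyXsubC_eq0 //.
  by rewrite size_Mmonic ?polyXsubC_eq0 ?monicXsubC // !size_XsubC szs; lia.
have p10 : p1.[0] != 0.
  rewrite /p1 !hornerE (skewrec_horner0 ss1).
  by rewrite !mulf_neq0 ?oppr_eq0 ?signr_eq0.
have block p2 e2 : quad_model B' p2 e2 -> exists e, quad_model B (p1 * p2) e.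
  move=> qm2; have [e qe] := quad_model_block sp1 p10 rel1 free1 one1 qm2.
  exact: quad_model_similar nE simB qe.
have [m0|m_gt0] := posnP m.
  have [e2 qm2] : exists e, quad_model B' 1 e.
    by move: B' {simB detB detB'0 block}; rewrite m0; apply: quad_model0.
  have [e qe] := block _ _ qm2; exists s1, e.
  have -> : - \det B / a = b1.
    rewrite detB; suff -> : \det B' = 1 by rewrite mulr1.
    by move: B' {simB detB detB'0 block qm2 qe}; rewrite m0 => B'; rewrite det_mx00.
  by split; [rewrite nE m0 addn0 | rewrite mulr1 in qe].
have [||||s2 [e2 [ss2 qm2]]] := IHN m B' (- b1^-1).
- by move: nE leN; lia.
- by [].
- by rewrite unitmxE unitfE.
- by rewrite oppr_eq0 invr_eq0.
have [e qe] := block _ _ qm2.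
exists (s1 * (('X - b1%:P) * ('X - (- b1^-1)%:P)) * s2), e; split.
  have -> : (n.+1.-1 = d.-1 + 1 + m.-1)%N by lia.
  by apply: skewrecM => //; apply: skewrecM => //; apply: skewrec1.
have bE : - \det B' / - b1^-1 = - \det B / a.
  rewrite invrN invrK detB /b1; ring.
rewrite bE in qe; set q := _ * _ in qe; set q' := _ * _ * _.
suff <- : q = q' by [].
rewrite /q /q' /p1; ring.
Qed.

(** For k = 1 the element z = p of F[t]/(p (t - c)) is killed by t - c, and the
    remainder p q of the quadratic relation is the multiple q(c) z of it.  For
    k = 0 there is nothing to add; both cases are handled at once. *)
Lemma quad_model_companion (F : fieldType) n k (B : 'M[F]_n) (p : {poly F}) e (c : F) :
  (k <= 1)%N -> quad_model B p e ->
  exists (Y : 'M_n) (x : 'M_(n, k)) y,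
    model (p * ('X - c%:P) ^+ k)
      (block_mx (block_mx 0 1%:M B Y) (col_mx 0 x) 0 c%:M : 'M_((n + n) + k)) y.
Proof.
move=> k1 [sp p0 [Y [q rel]] free _].
have pn0 : p != 0 by rewrite -size_poly_eq0 sp.
pose z : 'cV[{poly F}]_k := const_mx p; set p' := p * _.
have [x [q1 xE]] : exists (x : 'M_(n, k)) q1, p *: q = Cmx x *m z + p' *: q1.
  have [k0|k_gt0] := posnP k.
    exists 0, q; rewrite map_mx0 mul0mx add0r /p' [X in _ ^+ X]k0 expr0 mulr1 //.
  have kE : k = 1%N by lia.
  exists (\matrix_(j, l) (q j 0).[c]), (\col_j (q j 0 %/ ('X - c%:P))).
  apply/colP => j; rewrite !mxE.
  rewrite (eq_bigr (fun=> (q j 0).[c]%:P * p)) => [|l _]; last by rewrite !mxE.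
  rewrite sumr_const card_ord kE mulr1n /p' [X in _ ^+ X]kE expr1.
  rewrite {1}(divp_eq (q j 0) ('X - c%:P)) modp_XsubC; ring.
have [q2 zE] : exists q2, 'X *: z = c%:P *: z + p' *: q2.
  have [k0|k_gt0] := posnP k.
    by exists 0; apply/colP => j; have := ltn_ord j; lia.
  have kE : k = 1%N by lia.
  by exists (const_mx 1); apply/colP => j; rewrite !mxE /p' [X in _ ^+ X]kE; ring.
exists Y, x, (col_mx (col_mx e ('X *: e)) z); split.
- rewrite size_Mmonic ?monic_exp ?monicXsubC // sp.
  have -> : size (('X - c%:P) ^+ k) = k.+1.
    by rewrite polySpred ?size_exp ?size_XsubC ?mul1n // monic_neq0 ?monic_exp ?monicXsubC.
  by rewrite addnS /= -addnn addSn.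
- move=> r; rewrite -[r]hsubmxK -[lsubmx r]hsubmxK.
  move: (lsubmx (lsubmx r)) (rsubmx (lsubmx r)) (rsubmx r) => r1 r2 r3.
  rewrite !map_row_mx !mul_row_col -scalemxAr scalemxAl -mulmxDl.
  rewrite mxE; set W := _ *m e; have -> : (Cmx r3 *m z) 0 0 = (\sum_j r3 0 j)%:P * p.
    by rewrite mxE rmorph_sum mulr_suml; apply: eq_bigr => j _; rewrite !mxE.
  move=> dv; have [r10 r20] : r1 = 0 /\ r2 = 0.
    apply: free; rewrite -/W -(dvdp_addl (n := (\sum_j r3 0 j)%:P * p)) ?dvdp_mull //.
    by apply: dvdp_trans dv; rewrite dvdp_mulr.
  suff -> : r3 = 0 by rewrite r10 r20 !row_mx0.
  move: dv; rewrite /W r10 r20 map_mx0 scaler0 addr0 mul0mx mxE add0r mulrC /p' dvdp_mul2l //.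
  have [k0|k_gt0 dv] := posnP k; first by move=> _; apply/rowP => j; have := ltn_ord j; lia.
  have kE : k = 1%N by lia.
  apply/rowP => j; have := dv; rewrite [X in _ ^+ X]kE (bigD1 j) //= big1 => [|l]; last first.
    by case/eqP; apply: val_inj; have := ltn_ord l; have := ltn_ord j; rewrite /=; lia.
  rewrite addr0 expr1 mxE; apply: contraTeq => r30.
  by rewrite gtNdvdp ?polyC_eq0 // size_XsubC size_polyC r30.
exists (col_mx (col_mx 0 q1) q2).
rewrite !map_block_mx map_col_mx !map_mx0 map_mx1 map_scalar_mx !mul_block_col mul_col_mx.
rewrite !mul0mx !mul1mx mul_scalar_mx !add0r !add_col_mx addr0 !scale_col_mx !add_col_mx.
by rewrite scaler0 addr0 scalerA -expr2 rel -scalemxAr xE zE !addrA.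
Qed.

(** * Reduction to the quadratic models *)

(** Of the possible orders of the three factors, the one with the involution in
    the middle is the one produced by the linearization. *)
Definition U2_inv_U2 (F : fieldType) N (M : 'M[F]_N) :=
  exists U T : 'M[F]_N, [/\ (U - 1%:M) *m (U - 1%:M) = 0, inv_U2 T & M = U *m T].

Lemma U2_inv_U2_similar (F : fieldType) a b (M : 'M[F]_a) (N : 'M[F]_b) :
  mxsimilar M N -> U2_inv_U2 N -> U2_inv_U2 M.
Proof.
move=> [P [Q [PQ QP PM]]] [U [T [UU iT NE]]].
exists (Q *m U *m P), (Q *m T *m P); split.
- have -> : Q *m U *m P - 1%:M = Q *m (U - 1%:M) *m P.
    by rewrite mulmxBr mulmxBl mulmx1 QP.
  by rewrite !mulmxA -[_ *m P *m Q]mulmxA PQ mulmx1 -[Q *m _ *m _]mulmxA UU mulmx0 mul0mx.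
- apply: inv_U2_similar iT; exists P, Q; split=> //.
  by rewrite !mulmxA PQ mul1mx.
rewrite !mulmxA -[_ *m P *m Q]mulmxA PQ mulmx1 -[Q *m U *m T]mulmxA -NE.
by rewrite -mulmxA -PM mulmxA QP mul1mx.
Qed.

Lemma U2_inv_U2_block (F : fieldType) a b (M : 'M[F]_a) (N : 'M[F]_b) :
  U2_inv_U2 M -> U2_inv_U2 N -> U2_inv_U2 (block_mx M 0 0 N).
Proof.
have sq0 c d (X : 'M[F]_c) (Y : 'M_d) : (X - 1%:M) *m (X - 1%:M) = 0 ->
    (Y - 1%:M) *m (Y - 1%:M) = 0 ->
    (block_mx X 0 0 Y - 1%:M) *m (block_mx X 0 0 Y - 1%:M) = 0.
  move=> XX YY; rewrite scalar_mx_block opp_block_mx add_block_mx !oppr0 !addr0 mulmx_block.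
  by rewrite !mulmx0 !mul0mx !addr0 add0r XX YY block_mx0.
move=> [U [T [UU [S [V [SS VV ->]]] ->]]] [U' [T' [UU' [S' [V' [SS' VV' ->]]] ->]]].
exists (block_mx U 0 0 U'), (block_mx S 0 0 S' *m block_mx V 0 0 V'); split.
- exact: sq0.
- exists (block_mx S 0 0 S'), (block_mx V 0 0 V'); split=> //; last exact: sq0.
  by rewrite mulmx_block !mulmx0 !mul0mx !addr0 add0r SS SS' -scalar_mx_block.
by rewrite !mulmx_block !mulmx0 !mul0mx !addr0 !add0r !mulmx0 ?mul0mx ?addr0.
Qed.

(** In size 2, S = i [[-1, 1], [-2, 1]] is an involution because the
    second matrix has square -1. *)
Lemma U2_inv_U2_scalar (F : fieldType) (i : F) j : i ^+ 2 = -1 ->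
  U2_inv_U2 (i%:M : 'M_(j + j)).
Proof.
move=> i2.
have ii : i * i = -1 by rewrite -expr2.
pose m (a b c d : F) : 'M_(j + j) := block_mx a%:M b%:M c%:M d%:M.
have mM a b c d a' b' c' d' : m a b c d *m m a' b' c' d' =
    m (a * a' + b * c') (a * b' + b * d') (c * a' + d * c') (c * b' + d * d').
  by rewrite /m mulmx_block -!scalar_mxM -!raddfD.
have mC a : a%:M = m a 0 0 a by rewrite /m scalar_mx_block raddf0.
have mB1 a b c d : m a b c d - 1%:M = m (a - 1) b c (d - 1).
  by rewrite mC /m opp_block_mx add_block_mx -!raddfN -!raddfD !subr0.
have m0 : m 0 0 0 0 = 0 by rewrite /m raddf0 block_mx0.
exists (m 1 (-1) 0 1), (m (- i) i (- i *+ 2) i *m m 1 0 2%:R 1); split.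
- by rewrite mB1 mM -m0; congr m; ring.
- exists (m (- i) i (- i *+ 2) i), (m 1 0 2%:R 1); split=> //.
    by rewrite mM [RHS]mC; congr m; ring: ii.
  by rewrite mB1 mM -m0; congr m; ring.
by rewrite !mM mC; congr m; ring.
Qed.

(** The factor U subtracts X times the first block row, and a multiple of x, from
    the second block row; X = Y - A - i is arbitrary along with Y.  After a
    conjugation by [[1, 0], [i, 1]] the result is the linearization with
    constant term - i A. *)
Lemma U2_inv_U2_of_quad_model (F : fieldType) n k (i : F) (A : 'M[F]_n)
    (Y : 'M_n) (x : 'M_(n, k)) : i ^+ 2 = -1 ->
  inv_U2 (block_mx (block_mx 0 1%:M ((- i) *: A) Y) (col_mx 0 x) 0 i%:M) ->
  U2_inv_U2 (block_mx (block_mx i%:M 1%:M 0 A) 0 0 (i%:M : 'M_k)).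
Proof.
move=> i2 iK; pose X := Y - A - i%:M.
pose U : 'M_((n + n) + k) :=
  block_mx (block_mx 1%:M 0 (- X) 1%:M) (col_mx 0 (i *: x)) 0 1%:M.
pose W (c : F) : 'M[F]_((n + n) + k) := block_mx (block_mx 1%:M 0 c%:M 1%:M) 0 0 1%:M.
have WW c : W c *m W (- c) = 1%:M.
  rewrite /W !mulmx_block !(mulmx0, mul0mx, mulmx1, mul1mx, addr0, add0r).
  by rewrite -raddfD /= addrN raddf0 -!scalar_mx_block.
exists U, (W (- i) *m block_mx (block_mx 0 1%:M ((- i) *: A) Y) (col_mx 0 x) 0 i%:M *m W i).
split.
- rewrite /U (scalar_mx_block (n + n) k) (scalar_mx_block n n).
  rewrite !opp_block_mx !add_block_mx !oppr0 !subrr.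
  rewrite !addr0 mulmx_block mulmx_block !(mulmx0, mul0mx, addr0, add0r).
  by rewrite mul_block_col !mul0mx !addr0 mulmx0 col_mx0 !block_mx0.
- apply: inv_U2_similar iK; exists (W i), (W (- i)); split.
  + exact: WW.
  + by have := WW (- i); rewrite opprK.
  by rewrite !mulmxA WW mul1mx.
rewrite /U /W !mulmx_block !(mulmx0, mul0mx, mulmx1, mul1mx, addr0, add0r).
rewrite !mulmx_block !(mulmx0, mul0mx, mulmx1, mul1mx, addr0, add0r).
congr (block_mx (block_mx _ _ _ _) _ _ _).
- rewrite !mul_mx_scalar /X; apply/matrixP => u v; rewrite !mxE.
  by case: (u == v); rewrite ?mulr1n ?mulr0n; ring: i2.
- by rewrite /X; apply/matrixP => u v; rewrite !mxE; case: (u == v); rewrite ?mulr1n ?mulr0n; ring.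
rewrite !mul_block_col !(mulmx0, mul0mx, mul1mx, addr0, add0r) mul_col_mx mul0mx.
by rewrite mul_mx_scalar scalerA -expr2 i2 scaleN1r add_col_mx addrN addr0 col_mx0.
Qed.

(** For k = 0 the first root is 1 and the second one is - det B.  For k = 1 the
    first root is i det B, whose square is 1, the second one is i, and the
    scalar block contributes one more root i. *)
Lemma U2_inv_U2_core (F : fieldType) n k (i : F) (A : 'M[F]_n) :
  2%:R != 0 :> F -> i ^+ 2 = -1 -> (0 < n)%N -> (k <= 1)%N -> A \in unitmx ->
  (\det ((- i) *: A)) ^+ 2 = (-1) ^+ k ->
  U2_inv_U2 (block_mx (block_mx i%:M 1%:M 0 A) 0 0 (i%:M : 'M_k)).
Proof.
move=> two_n0 i2 n0 k1 uA detB2; set B := (- i) *: A in detB2.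
have i0 : i != 0 by apply: contra_eq_neq i2 => ->; rewrite expr0n eq_sym oppr_eq0 oner_eq0.
have uB : B \in unitmx by rewrite unitmxZ // unitfE oppr_eq0.
have iV : - i^-1 = i.
  by apply: (mulfI i0); rewrite mulrN mulfV // -expr2 i2.
suff [Y [x iK]] : exists Y (x : 'M_(n, k)),
    inv_U2 (block_mx (block_mx 0 1%:M B Y) (col_mx 0 x) 0 i%:M).
  exact: U2_inv_U2_of_quad_model iK.
have [k0|k_gt0] := posnP k.
  have detB21 : (\det B) ^+ 2 = 1 by rewrite detB2 k0.
  have [s [e [ss qm]]] := quad_model_exists n0 uB (oner_neq0 F).
  have [Y [x [y mK]]] := quad_model_companion i k1 qm.
  have [T [z [iT mT]]] :=
    inv_U2_model two_n0 (expr1n _ 2) (e' := - \det B) (etrans (sqrrN _) detB21) (leqnn 1) ss.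
  exists Y, x; apply: inv_U2_similar iT; apply: (model_similar mT).
  move: mK; rewrite [X in _ ^+ X]k0 expr0 mulr1 expr1 divr1.
  rewrite [('X - 1%:P) * s * _]mulrAC => mK; exact: mK.
have kE : k = 1%N by lia.
have a2 : (i * \det B) ^+ 2 = 1 by rewrite exprMn i2 detB2 kE expr1 mulrNN mulr1.
have a0 : i * \det B != 0 by apply: contra_eq_neq a2 => ->; rewrite expr0n eq_sym oner_eq0.
have [s [e [ss qm]]] := quad_model_exists n0 uB a0.
have bE : - \det B / (i * \det B) = i.
  rewrite invfM mulrCA mulNr mulfV ?mulrN1 //.
  by apply: contraNneq a0 => ->; rewrite mulr0.
rewrite bE in qm.
have [Y [x [y mK]]] := quad_model_companion i k1 qm.
have ss' : skewrec n ((('X - i%:P) * ('X - (- i^-1)%:P)) * s).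
  have -> : n = (1 + n.-1)%N by lia.
  by apply: skewrecM ss; apply: skewrec1.
have [T [z [iT mT]]] := inv_U2_model two_n0 a2 (expr1n _ 2) (leq0n 1) ss'.
exists Y, x; apply: inv_U2_similar iT; apply: (model_similar mT).
move: mK; rewrite [X in _ ^+ X]kE expr0 mulr1 expr1 iV.
have -> : ('X - (i * \det B)%:P) * (('X - i%:P) * ('X - i%:P) * s) =
    ('X - (i * \det B)%:P) * ('X - i%:P) * s * ('X - i%:P) by ring.
by move=> mK; exact: mK.
Qed.

(** Let C be a basis of the row space of E = A - i, so that E = R C.  In the basis
    made of C, of vectors (e1, u1) with e1 R = 1, and of vectors killed by
    A (+) i - i, the matrix has the stated shape.  The second components u1, which
    exist because r >= rank E, keep these vectors independent of C. *)
Lemma mxsimilar_rank_reduction (F : fieldType) n r (i : F) (A : 'M[F]_n) : (n <= r)%N ->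
  exists m (A' : 'M[F]_m) k, [/\ (n + r = (m + m) + k)%N &
    mxsimilar (block_mx A 0 0 (i%:M : 'M_r))
              (block_mx (block_mx i%:M 1%:M 0 A') 0 0 (i%:M : 'M_k))].
Proof.
move=> nr; pose E := A - i%:M; set m := \rank E.
have AE : A = E + i%:M by rewrite subrK.
have [k0 rE] : exists k0, r = (m + k0)%N.
  by exists (r - m)%N; rewrite subnKC // (leq_trans (rank_leq_row _) nr).
rewrite {r}rE in nr *.
have [C [R [e1 [RC e1R freeC]]]] : exists (C : 'M_(m, n)) (R : 'M_(n, m)) (e1 : 'M_(m, n)),
    [/\ R *m C = E, e1 *m R = 1%:M & row_free C].
  exists (row_base E), (col_base E), (pinvmx (col_base E)).
  by rewrite mulmx_base mulVpmx ?col_base_full ?row_base_free.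
have [k1 [D [k1E freeCD]]] : exists k1 (D : 'M_(k1, n)),
    (m + k1 = n)%N /\ row_free (col_mx C D).
  have rankE : (m + \rank (C^C)%MS = n)%N.
    by rewrite mxrank_compl (eqP freeC) subnKC ?rank_leq_row.
  exists (\rank (C^C)%MS), (row_base (C^C)%MS); split=> //.
  rewrite /row_free [X in _ == X]rankE -addsmxE.
  rewrite (adds_eqmx (eqmx_refl C) (eq_row_base _)).
  exact: addsmx_compl_full.
pose u1 : 'M[F]_(m, m + k0) := row_mx 1%:M 0.
pose u2 : 'M[F]_(k0, m + k0) := row_mx 0 1%:M.
pose P : 'M_((m + m) + (k1 + k0), n + (m + k0)) :=
  col_mx (col_mx (row_mx e1 u1) (row_mx C 0))
         (col_mx (row_mx (D - D *m R *m e1) (- (D *m R) *m u1)) (row_mx 0 u2)).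
have dimE : (n + (m + k0) = (m + m) + (k1 + k0))%N by rewrite -[in LHS]k1E; lia.
have [|Q [PQ QP]] := @row_free_inverse F _ _ P dimE.
  rewrite -kermx_eq0; apply/rowV0P => u /sub_kermxP.
  rewrite -[u]hsubmxK -[lsubmx u]hsubmxK -[rsubmx u]hsubmxK.
  move: (lsubmx (lsubmx u)) (rsubmx (lsubmx u)) (lsubmx (rsubmx u)) (rsubmx (rsubmx u)).
  move=> ue uf v1 v2; rewrite !mul_row_col !mul_mx_row !add_row_mx !mulmx0 !addr0 !add0r.
  rewrite -row_mx0 => /eq_row_mx[E1]; rewrite !mulmx1 add_row_mx add0r -row_mx0.
  move=> /eq_row_mx[/eqP E2 ->]; rewrite mulmxN subr_eq0 in E2.
  have CD0 : row_mx uf v1 *m col_mx C D = 0.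
    rewrite mul_row_col -[RHS]E1 (eqP E2) mulmxBr !mulmxA.
    move: (uf *m C) (v1 *m D) (v1 *m D *m R *m e1) => b c d.
    by rewrite [d + b]addrC -addrA [d + _]addrC subrK.
  have := row_free_inj freeCD; move/(_ _ (row_mx uf v1) 0); rewrite CD0 mul0mx.
  move/(_ erefl); rewrite -row_mx0 => /eq_row_mx[uf0 v10].
  by rewrite (eqP E2) v10 uf0 mul0mx !row_mx0.
have A'C : (i%:M + C *m R) *m C = C *m A.
  by rewrite AE mulmxDl mulmxDr -RC mul_scalar_mx mul_mx_scalar addrC mulmxA.
have e1A : e1 *m A = i *: e1 + C.
  by rewrite AE mulmxDr -RC mulmxA e1R mul1mx mul_mx_scalar addrC.
exists m, (i%:M + C *m R), (k1 + k0)%N; split=> //; exists P, Q; split=> //.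
rewrite /P [RHS]mul_block_col [X in col_mx (X + _) _]mul_block_col.
rewrite [LHS]mul_col_mx [X in col_mx X _ = _]mul_col_mx [X in col_mx _ X = _]mul_col_mx.
rewrite !mul_row_block !mul0mx !mulmx0 !mul_scalar_mx !mul_mx_scalar scale1r !(addr0, add0r).
rewrite !mul_mx_row !scale_col_mx !scale_row_mx mulmx0 scaler0 add_row_mx addr0.
rewrite A'C e1A; congr (col_mx (col_mx _ _) (col_mx (row_mx _ _) _)); last by rewrite !scaler0.
have DA : D *m A = i *: D + D *m R *m C.
  by rewrite AE mulmxDr -RC mul_mx_scalar mulmxA addrC.
rewrite mulmxBl DA -[_ *m e1 *m A]mulmxA e1A mulmxDr -scalemxAr scalerBr.
by rewrite [_ + D *m R *m C in X in _ - X]addrC addrKA.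
Qed.

Lemma mxsimilar_castmx (F : fieldType) a b (e : a = b) (M : 'M[F]_a) :
  mxsimilar (castmx (e, e) M) M.
Proof. by case: _ / e; exists 1%:M, 1%:M; split; rewrite ?castmx_id ?mul1mx ?mulmx1. Qed.

Lemma U2_inv_U2_empty (F : fieldType) N (M : 'M[F]_N) : N = 0%N -> U2_inv_U2 M.
Proof.
move=> N0; have flat (X Y : 'M[F]_N) : X = Y by apply/matrixP => i; have := ltn_ord i; lia.
by exists 1%:M, 1%:M; split; [| exists 1%:M, 1%:M; split |]; apply: flat.
Qed.

Theorem theorem1p13 (F : fieldType) (char_not2 : 2%N \notin [pchar F])
    (i : F) (sqr_i : i ^+ 2 = -1)
    (n : nat) (A : 'M[F]_n) (A_unit : A \in unitmx)
    (r : nat) (le_nr : (n <= r)%N)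
    (det_cond : i ^+ r * \det A = 1 \/ i ^+ r * \det A = -1) :
  is_prod_involution_U2_U2 (direct_sum_mx A (i%:M : 'M[F]_r)).
Proof.
have two_n0 : 2%:R != 0 :> F by move: char_not2; rewrite inE /=.
suff [U [T [UU [S [V [SS VV ->]]] ->]]] : U2_inv_U2 (direct_sum_mx A (i%:M : 'M[F]_r)).
  have U2_unit (X : 'M[F]_(n + r)) : (X - 1%:M) *m (X - 1%:M) = 0 -> X \in unitmx.
    move=> XX; have /mulmx1_unit[] // : X *m (1%:M - (X - 1%:M)) = 1%:M.
    rewrite -[X in X *m _](subrK 1%:M) mulmxDl mul1mx mulmxBr mulmx1 XX subr0.
    by rewrite addrC subrK.
  exists S, U, V; split; first 1 last.
  - by split; first exact: U2_unit.
  - by split; first exact: U2_unit.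
  - by apply: Or32; rewrite mulmxA.
  by split=> //; have [] := mulmx1_unit SS.
have [m [B [K [dimE sim]]]] := mxsimilar_rank_reduction i A le_nr.
apply: (U2_inv_U2_similar sim).
have detE := mxsimilar_det dimE sim; rewrite !det_ublock !det_scalar mulrC in detE.
(* Only the square of the determinant is used: it does not see the sign. *)
have sq1 : (i ^+ m * \det B * i ^+ K) ^+ 2 = 1.
  by rewrite -detE; case: det_cond => ->; rewrite ?sqrrN expr1n.
have detB2 : (\det ((- i) *: B)) ^+ 2 = (-1) ^+ odd K.
  have sqrX k : (i ^+ k) ^+ 2 = (-1) ^+ k by rewrite -exprM mulnC exprM sqr_i.
  rewrite signr_odd detZ exprMn -exprM mulnC exprM sqrrN sqr_i.
  rewrite !exprMn !sqrX in sq1.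
  by rewrite -[LHS](signrMK K) [X in _ * X]mulrC sq1 mulr1.
have uB : B \in unitmx.
  rewrite unitmxE unitfE; apply: contra_eq_neq sq1 => ->.
  by rewrite mulr0 mul0r expr0n eq_sym oner_eq0.
have KE : K = (odd K + (K./2 + K./2))%N by rewrite addnn odd_double_half.
rewrite KE (scalar_mx_block (odd K)) -(row_mx0 _ _ (odd K)) -(col_mx0 _ (odd K)) block_mxA.
apply: U2_inv_U2_similar (mxsimilar_castmx _ _) _.
rewrite row_mx0 col_mx0; apply: U2_inv_U2_block; last exact: U2_inv_U2_scalar.
(* For m = 0 the determinant of the scalar block alone makes K even. *)
have [m0|m_gt0] := posnP m; last exact: U2_inv_U2_core (leq_b1 _) uB detB2.
apply: U2_inv_U2_empty; move: detB2 {sim dimE detE uB}; rewrite m0 in B sq1 *.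
rewrite det_mx00 expr1n; case: (odd K) => //; rewrite expr1 => /eqP.
by rewrite eq_sym -subr_eq0 -opprD oppr_eq0 (negPf two_n0).
Qed.
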